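(* Let $c=5/4$, $\alpha>2$, $\lambda_b>0$, $P>0$, $\tilde\sigma^2\ge 0$ and $\omega>0$ be constants. Let $d_1,d_2$ be independent random variables, each with probability density $f_d(x)=2c\lambda_b\pi x e^{-c\lambda_b\pi x^2}$, $x\ge 0$, and let $d=\max\{d_1,d_2\}$. For $s\in\mathbb{C}$ with $\mathrm{Re}(s)>0$ define $$\varphi(s)=\mathbb{E}\left\{\exp\left(-\frac{\tilde\sigma^2}{P}\,s\,d^{\alpha}-\pi\lambda_b\,\omega\, d^2 s^{2/\alpha}\right)\right\}.$$ Then $$\varphi(s)=\frac{2c}{c+\omega s^{2/\alpha}}\,H_{1,1}^{1,1}\left(\frac{\tilde\sigma^2}{P}\,s\left(\pi\lambda_b\left(c+\omega s^{2/\alpha}\right)\right)^{-\alpha/2}\right)-\frac{2c}{2c+\omega s^{2/\alpha}}\,H_{1,1}^{1,1}\left(\frac{\tilde\sigma^2}{P}\,s\left(\pi\lambda_b\left(2c+\omega s^{2/\alpha}\right)\right)^{-\alpha/2}\right),$$ where $H_{1,1}^{1,1}(x)$ denotes the Fox H-function $H_{1,1}^{1,1}\left(x\,\middle|\,\begin{smallmatrix}(0,\alpha/2)\\(0,1)\end{smallmatrix}\right)$. Moreover, for fixed $s$ (and fixed $\omega,\lambda_b,\alpha$), in the limit $\tilde\sigma^2/P\to 0$, $$\varphi(s)\to\frac{2c}{c+\omega s^{2/\alpha}}-\frac{2c}{2c+\omega s^{2/\alpha}}.$$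
   Context: Model: small-cell base stations form a homogeneous Poisson point process of intensity $\lambda_b$; the distance between a user and its serving (closest) base station is modeled by the density $f_d$ above. Under random NOMA grouping, two users are paired and the far user's link distance $d$ is the larger of the two i.i.d. distances. Here $\tilde\sigma^2=\sigma^2\|\mathbf{u}\|^2$ is the filtered noise power, $P$ the transmit power per stream, and $\omega$ plays the role of $\Gamma(1-2/\alpha)\left(\frac{\rho_I}{P}|\mathbf{u}^{\mathrm H}\mathbf{1}|^2\right)^{2/\alpha}$ (interference-related constant), treated as a fixed positive number. Powers $s^{2/\alpha}$, $(\cdot)^{-\alpha/2}$ and $x^{-\xi}$ use principal branches. The Fox H-function is defined by the Mellin–Barnes integral $H_{1,1}^{1,1}\left(x\,\middle|\,\begin{smallmatrix}(0,\alpha/2)\\(0,1)\end{smallmatrix}\right)=\frac{1}{2\pi \mathrm{i}}\int_{\mathcal L}\Gamma(\xi)\,\Gamma\left(1-\tfrac{\alpha}{2}\xi\right)x^{-\xi}\,d\xi$, where $\mathcal L$ is a vertical line $\mathrm{Re}(\xi)=\gamma$ with $0<\gamma<2/\alpha$ separating the poles of $\Gamma(\xi)$ from those of $\Gamma(1-\frac{\alpha}{2}\xi)$.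
   Formalization: For zero noise power the Fox H-function is evaluated at x = 0, where its Mellin–Barnes integral is undefined; the value H(0) = 1 (its continuous extension) is used there. *)

(* Defs.v *)
From Stdlib Require Import Reals.
From Coquelicot Require Import Coquelicot.
Open Scope R_scope.

Definition ccst : R := 5 / 4.

Definition Cexpc (z : C) : C :=
  (exp (fst z) * cos (snd z), exp (fst z) * sin (snd z)).

(** Principal argument, with values in (-PI, PI]  (Arg 0 = 0). *)
Definition Argc (z : C) : R :=
  let a := fst z in let b := snd z in
  match Rlt_dec 0 a with
  | left _ => atan (b / a)
  | right _ =>
    match Rlt_dec a 0 with
    | left _ => if Rle_dec 0 b then atan (b / a) + PI else atan (b / a) - PI
    | right _ =>
      match Rlt_dec 0 b with
      | left _ => PI / 2
      | right _ => if Rlt_dec b 0 then - (PI / 2) else 0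
      end
    end
  end.

Definition Clogc (z : C) : C := (ln (Cmod z), Argc z).

(** Principal complex power z^w = exp(w Log z); convention 0^w = 0. *)
Definition Cpowc (z w : C) : C :=
  if Req_EM_T (fst z) 0 then
    (if Req_EM_T (snd z) 0 then 0%C else Cexpc (Cmult w (Clogc z)))
  else Cexpc (Cmult w (Clogc z)).

(** Real power x^a for x >= 0 (with 0^a = 0, a > 0 in our uses). *)
Definition Rpow0 (x a : R) : R := if Rle_dec x 0 then 0 else Rpower x a.

Definition CInt_gen (f : R -> C) (F G : (R -> Prop) -> Prop) : C :=
  (RInt_gen (fun t => fst (f t)) F G, RInt_gen (fun t => snd (f t)) F G).

Definition CInt0inf (f : R -> C) : C :=
  CInt_gen f (at_right 0) (Rbar_locally p_infty).

Definition CIntR (f : R -> C) : C :=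
  CInt_gen f (Rbar_locally m_infty) (Rbar_locally p_infty).

(** Complex Gamma function by Euler's integral (valid for Re z > 0, which
    is the case for every argument used below). *)
Definition CGamma (z : C) : C :=
  CInt0inf (fun t => Cmult (RtoC (exp (- t))) (Cpowc (RtoC t) (Cminus z 1%C))).

(** Fox H-function H^{1,1}_{1,1}(x | (0,alpha/2) ; (0,1)) as the
    Mellin-Barnes integral along Re(xi) = gam:
    (1/(2 pi i)) int_{gam - i oo}^{gam + i oo} Gamma(xi) Gamma(1 - alpha/2 xi) x^{-xi} dxi
    = (1/(2 pi)) int_R Gamma(gam+it) Gamma(1-alpha/2 (gam+it)) x^{-(gam+it)} dt.
    At x = 0 we use the value H(0) = 1 (the continuous extension;
    the residue of Gamma at 0). *)
Definition FoxH (alpha gam : R) (x : C) : C :=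
  if Req_EM_T (fst x) 0 then
    (if Req_EM_T (snd x) 0 then 1%C else
       Cmult (RtoC (/ (2 * PI))) (CIntR (fun t =>
         let xi := (gam, t) in
         Cmult (Cmult (CGamma xi) (CGamma (Cminus 1%C (Cmult (RtoC (alpha / 2)) xi))))
               (Cpowc x (Copp xi)))))
  else
    Cmult (RtoC (/ (2 * PI))) (CIntR (fun t =>
      let xi := (gam, t) in
      Cmult (Cmult (CGamma xi) (CGamma (Cminus 1%C (Cmult (RtoC (alpha / 2)) xi))))
            (Cpowc x (Copp xi)))).

Definition fd (lam x : R) : R :=
  2 * ccst * lam * PI * x * exp (- (ccst * lam * PI * x ^ 2)).

(** E{ g(max(d1,d2)) } for d1, d2 independent with density fd:
    int_0^oo int_0^oo g(max x y) fd(x) fd(y) dy dx. *)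
Definition Emax (lam : R) (g : R -> C) : C :=
  CInt0inf (fun x => CInt0inf (fun y =>
    Cmult (RtoC (fd lam x * fd lam y)) (g (Rmax x y)))).

Definition phi (alpha lam omega sig2 P : R) (s : C) : C :=
  Emax lam (fun d =>
    Cexpc (Cminus
      (Copp (Cmult (RtoC (sig2 / P * Rpow0 d alpha)) s))
      (Cmult (RtoC (PI * lam * omega * d ^ 2)) (Cpowc s (RtoC (2 / alpha)))))).

(* Main.v *)
(* Substituting x = exp v turns every integral into one over the real line.  For
   0 < Re xi and |Im z| < pi/2, Cauchy's theorem on a parallelogram gives
     int exp (- exp (v + z) + xi v) dv = Gamma xi * exp (- xi z),
   which also yields the exponential decay of Gamma on vertical lines.  Read as
   a Fourier transform in v with xi = g + i t, it is inverted at v = 0 by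
   Poisson means:
     int Gamma (g + i t) exp (- (g + i t) z) dt = 2 pi exp (- exp z).
   Inserting this for exp (- k s r^beta), with beta = alpha / 2, in the Laplace
   integral of exp (- B r - k s r^beta) and exchanging the integrals (the
   integrand is dominated by a product) produces B^-1 times the Mellin-Barnes
   integral at k s B^-beta.  Since arg B lies between 0 and arg s / beta, the
   argument of k s B^-beta stays in (-pi/2, pi/2), so no branch is crossed.
   Finally, the density of max (d1, d2) is 2 f F, a difference of two terms of
   this type, and |exp (- w) - 1| <= |w| gives the limit of vanishing noise. *)

Require Import Defs.
From Stdlib Require Import Reals Lra Lia FunctionalExtensionality.
From Coquelicot Require Import Coquelicot.
Open Scope R_scope.

(** * Fubini on rectangles *)

(** All integrals here are improper Riemann integrals, so convergence alone does not allow two of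
    them to be exchanged. Every exchange therefore rests on a continuous integrand dominated by a
    product [p x * q y] of two functions with small tails: the truncation errors are then uniform,
    and only rectangles remain. The exponential substitution sends both ends of a half-line to
    infinity, so that one notion of convergence serves everywhere and the singularity of Euler's
    integrand at 0 becomes exponential decay. A single family of majorants, [sech], then fits all
    kernels.

    The logarithms S of k s and b of B are the working parameters, so powers are plain exponentials
    and principal branches enter only when the result is read back as a Fox function. Vanishing
    noise has no such logarithm; there [FoxH] is 1 by definition, the Laplace integral is the
    inverse of B, and the formula is checked directly. *)

Lemma ex_RInt_cont (f : R -> R) (a b : R) :
  (forall x, continuous f x) -> ex_RInt f a b.
Proof.
  intros H. apply (ex_RInt_continuous (V:=R_CompleteNormedModule)). intros; apply H.
Qed.

Lemma continuity_2d_slice (f : R -> R -> R) (x y : R) :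
  continuity_2d_pt f x y -> continuous (fun u => f u y) x.
Proof.
  intros Hf. apply continuity_pt_filterlim. apply continuity_pt_locally. intros eps.
  destruct (Hf eps) as [d Hd].
  exists d. intros u Hu. apply Hd; [apply Hu|].
  rewrite Rminus_diag, Rabs_R0. apply cond_pos.
Qed.

Lemma continuous_RInt_param (f : R -> R -> R) (a b y0 : R) :
  (forall x y, continuity_2d_pt f x y) ->
  continuous (fun y => RInt (fun x => f x y) a b) y0.
Proof.
  intros Hf.
  assert (Hx : forall y x, continuous (fun x => f x y) x).
  { intros y x. now apply continuity_2d_slice. }
  assert (Hex : forall y c d, ex_RInt (fun x => f x y) c d).
  { intros y c d. apply ex_RInt_cont. apply Hx. }
  apply continuity_pt_filterlim. apply continuity_pt_locally. intros eps.
  (* The summand 1 keeps [K] positive when [a = b]. *)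
  set (K := Rabs (b - a) + 1).
  assert (HK : 0 < K) by (unfold K; generalize (Rabs_pos (b - a)); lra).
  assert (He : 0 < eps / K) by (apply Rdiv_lt_0_compat; [apply cond_pos | lra]).
  destruct (uniform_continuity_2d_1d f (Rmin a b) (Rmax a b) y0
     (fun x _ => Hf x y0) (mkposreal _ He)) as [d Hd].
  exists d. intros y Hy.
  change (Rabs (y - y0) < d) in Hy.
  replace (_ - _) with (RInt (fun x => f x y - f x y0) a b).
  2:{ apply (RInt_minus (V:=R_CompleteNormedModule) (fun x => f x y) (fun x => f x y0)); apply Hex. }
  apply Rle_lt_trans with (Rabs (b - a) * (eps / K)).
  - assert (Hex' : ex_RInt (fun x => f x y - f x y0) a b)
      by (apply (ex_RInt_minus (V:=R_NormedModule)); apply Hex).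
    apply (norm_RInt_le_const_abs (V:=R_NormedModule) (fun x => f x y - f x y0) a b _ (eps / K)).
    + intros x H1. left. apply Rabs_def2 in Hy. apply (Hd x y0 x y); try lra.
      rewrite Rminus_diag, Rabs_R0. apply cond_pos.
    + now apply (RInt_correct (V:=R_CompleteNormedModule)).
  - apply Rlt_le_trans with (K * (eps / K)).
    + apply Rmult_lt_compat_r; [exact He | unfold K; lra].
    + right. field. lra.
Qed.

(** As a function of the upper limit [b], the right side has the inner integral of the left side as
    its derivative (differentiation under the integral sign) and vanishes at [b = a]; the
    fundamental theorem of calculus does the rest. *)
Lemma RInt_fubini (f : R -> R -> R) (a b c d : R) :
  (forall x y, continuity_2d_pt f x y) ->
  RInt (fun x => RInt (fun y => f x y) c d) a b =
  RInt (fun y => RInt (fun x => f x y) a b) c d.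
Proof.
  intros Hf.
  assert (Hf' : forall x y, continuity_2d_pt (fun y x => f x y) x y).
  { intros x y eps. destruct (Hf y x eps) as [e He]. exists e. intros; now apply He. }
  assert (Hx : forall y x, continuous (fun x => f x y) x).
  { intros y x. now apply continuity_2d_slice. }
  assert (HD : forall x y, is_derive (fun u => RInt (fun x => f x y) a u) x (f x y)).
  { intros x y. apply (is_derive_RInt (fun x => f x y) _ a).
    - apply filter_forall. intros u. apply (RInt_correct (V:=R_CompleteNormedModule)).
      apply ex_RInt_cont. apply Hx.
    - apply Hx. }
  assert (HF : forall x, is_derive (fun x => RInt (fun y => RInt (fun u => f u y) a x) c d) x
                (RInt (fun y => f x y) c d)).
  { intros x.
    rewrite <- (RInt_ext (fun t => Derive (fun u => RInt (fun x => f x t) a u) x)).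
    2:{ intros t _. now apply is_derive_unique. }
    apply (is_derive_RInt_param (fun x y => RInt (fun u => f u y) a x)).
    - apply filter_forall. intros u t _. exists (f u t). apply HD.
    - intros t _. apply continuity_2d_pt_ext with f; [|apply Hf].
      intros u v. symmetry. now apply is_derive_unique.
    - apply filter_forall. intros u. apply ex_RInt_cont.
      intros y. now apply continuous_RInt_param. }
  assert (H := is_RInt_derive _ _ a b (fun x _ => HF x)
     (fun x _ => continuous_RInt_param (fun y x => f x y) c d x Hf')).
  apply (is_RInt_unique (V:=R_CompleteNormedModule)) in H. rewrite H.
  unfold minus, plus, opp; simpl.
  rewrite (RInt_ext (fun y => RInt (fun u => f u y) a a) (fun _ => 0)).
  - rewrite RInt_const. unfold scal; simpl; unfold mult; simpl. ring.
  - intros y _. apply (RInt_point (V:=R_CompleteNormedModule) a).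
Qed.

(** * Complex-valued functions of real variables *)

(** Continuity by components, because the integrals of the statement are taken by components. The
    domain is arbitrary, so that functions of one and of two real variables share the closure
    lemmas. *)
Definition ccont {U : UniformSpace} (f : U -> C) : Prop :=
  (forall x, continuous (fun u => fst (f u)) x) /\
  (forall x, continuous (fun u => snd (f u)) x).

Section Ccont.
Context {U : UniformSpace}.
Implicit Types f g : U -> C.

Lemma ccont_const (c : C) : ccont (fun _ : U => c).
Proof. split; intros x; apply continuous_const. Qed.

Lemma ccont_RtoC (f : U -> R) : (forall x, continuous f x) -> ccont (fun u => RtoC (f u)).
Proof. intros H; split; intros x; simpl; [apply H | apply continuous_const]. Qed.

Lemma ccont_pair (f g : U -> R) : (forall x, continuous f x) -> (forall x, continuous g x) ->
  ccont (fun u => (f u, g u)).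
Proof. intros H H'; split; intros x; simpl; auto. Qed.

Lemma ccont_plus f g : ccont f -> ccont g -> ccont (fun u => Cplus (f u) (g u)).
Proof.
  intros [f1 f2] [g1 g2]; split; intros x; simpl.
  - apply (continuous_plus (fun u => fst (f u)) (fun u => fst (g u))); auto.
  - apply (continuous_plus (fun u => snd (f u)) (fun u => snd (g u))); auto.
Qed.

Lemma ccont_opp f : ccont f -> ccont (fun u => Copp (f u)).
Proof.
  intros [f1 f2]; split; intros x; simpl.
  - apply (continuous_opp (fun u => fst (f u))); auto.
  - apply (continuous_opp (fun u => snd (f u))); auto.
Qed.

Lemma ccont_minus f g : ccont f -> ccont g -> ccont (fun u => Cminus (f u) (g u)).
Proof. intros; apply ccont_plus; [|apply ccont_opp]; auto. Qed.

Lemma ccont_mult f g : ccont f -> ccont g -> ccont (fun u => Cmult (f u) (g u)).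
Proof.
  intros [f1 f2] [g1 g2]; split; intros x; simpl.
  - apply (continuous_minus (fun u => fst (f u) * fst (g u)) (fun u => snd (f u) * snd (g u)));
    apply (continuous_mult (K:=R_AbsRing)); auto.
  - apply (continuous_plus (fun u => fst (f u) * snd (g u)) (fun u => snd (f u) * fst (g u)));
    apply (continuous_mult (K:=R_AbsRing)); auto.
Qed.

Lemma ccont_Cexpc f : ccont f -> ccont (fun u => Cexpc (f u)).
Proof.
  intros [f1 f2]; split; intros x; simpl; apply (continuous_mult (K:=R_AbsRing)).
  - apply continuous_comp; [apply f1 | apply continuous_exp].
  - apply continuous_comp; [apply f2 | apply continuous_cos].
  - apply continuous_comp; [apply f1 | apply continuous_exp].
  - apply continuous_comp; [apply f2 | apply continuous_sin].
Qed.

Lemma ccont_Cmod f x : ccont f -> continuous (fun u => Cmod (f u)) x.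
Proof.
  intros [f1 f2]. unfold Cmod.
  apply (continuous_comp (fun u => fst (f u) ^ 2 + snd (f u) ^ 2) sqrt).
  - apply (continuous_plus (fun u => fst (f u) ^ 2) (fun u => snd (f u) ^ 2)); simpl;
    repeat apply (continuous_mult (K:=R_AbsRing)); auto; apply continuous_const.
  - apply continuous_sqrt.
Qed.
End Ccont.

Lemma ccont_comp {U V : UniformSpace} (f : V -> C) (g : U -> V) :
  ccont f -> (forall x, continuous g x) -> ccont (fun u => f (g u)).
Proof.
  intros [f1 f2] Hg; split; intros x.
  - apply (continuous_comp g (fun v => fst (f v))); auto.
  - apply (continuous_comp g (fun v => snd (f v))); auto.
Qed.

Definition ccont2 (f : R -> R -> C) : Prop :=
  ccont (U := prod_UniformSpace R_UniformSpace R_UniformSpace) (fun p => f (fst p) (snd p)).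

Lemma ccont2_2d f : ccont2 f ->
  (forall x y, continuity_2d_pt (fun x y => fst (f x y)) x y) /\
  (forall x y, continuity_2d_pt (fun x y => snd (f x y)) x y).
Proof.
  intros [H1 H2]; split; intros x y; apply continuity_2d_pt_filterlim;
  [apply (H1 (x, y)) | apply (H2 (x, y))].
Qed.

Lemma ccont2_l f y : ccont2 f -> ccont (fun x => f x y).
Proof.
  intros H. destruct (ccont2_2d f H) as [H1 H2]. split; intros x.
  - apply (continuity_2d_slice (fun x y => fst (f x y))); auto.
  - apply (continuity_2d_slice (fun x y => snd (f x y))); auto.
Qed.

Lemma ccont2_swap f : ccont2 f -> ccont2 (fun y x => f x y).
Proof.
  intros H. unfold ccont2.
  apply (ccont_comp (V := prod_UniformSpace R_UniformSpace R_UniformSpace)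
     (fun p => f (fst p) (snd p))
     (fun p : prod_UniformSpace R_UniformSpace R_UniformSpace => (snd p, fst p)) H).
  intros [x y] P [eps HP]. exists eps. intros [u v] [Hu Hv].
  apply HP. split; assumption.
Qed.

Lemma ccont2_r f x : ccont2 f -> ccont (fun y => f x y).
Proof. intros H. apply (ccont2_l (fun y x => f x y)). now apply ccont2_swap. Qed.

(** * Complex integrals over a segment *)

Definition CRInt (f : R -> C) (a b : R) : C :=
  (RInt (fun t => fst (f t)) a b, RInt (fun t => snd (f t)) a b).

(** Ties the pair of real integrals to the integral in the normed space [C], from which the norm
    estimate, additivity and the splitting of intervals are inherited. *)
Lemma CRInt_is_RInt f a b : ccont f -> is_RInt (V := C_R_NormedModule) f a b (CRInt f a b).
Proof.
  intros [f1 f2]. apply (is_RInt_fct_extend_pair (U:=R_NormedModule) (V:=R_NormedModule) f).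
  - apply (RInt_correct (V:=R_CompleteNormedModule)). now apply ex_RInt_cont.
  - apply (RInt_correct (V:=R_CompleteNormedModule)). now apply ex_RInt_cont.
Qed.

Lemma is_RInt_CRInt f a b l : is_RInt (V := C_R_NormedModule) f a b l -> CRInt f a b = l.
Proof.
  intros H. unfold CRInt.
  apply (RInt_fct_extend_pair (U:=R_NormedModule) (V:=R_NormedModule) (RInt (V:=R_CompleteNormedModule)) (RInt (V:=R_CompleteNormedModule))); auto.
  - intros; now apply (is_RInt_unique (V:=R_CompleteNormedModule)).
  - intros; now apply (is_RInt_unique (V:=R_CompleteNormedModule)).
Qed.

Lemma norm_Cmod (z : C) : norm (z : C_R_NormedModule) = Cmod z.
Proof.
  unfold norm; simpl. unfold prod_norm, Cmod; simpl. f_equal.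
  unfold norm; simpl; unfold abs; simpl.
  rewrite !Rmult_1_r. unfold Rabs; repeat destruct Rcase_abs; ring.
Qed.

Lemma CRInt_norm f p a b : ccont f -> (forall x, continuous p x) -> a <= b ->
  (forall x, a <= x <= b -> Cmod (f x) <= p x) -> Cmod (CRInt f a b) <= RInt p a b.
Proof.
  intros Hf Hp Hab H. rewrite <- norm_Cmod.
  apply (norm_RInt_le (V:=C_R_NormedModule) f p a b); auto.
  - intros x Hx. rewrite norm_Cmod. auto.
  - now apply CRInt_is_RInt.
  - apply (RInt_correct (V:=R_CompleteNormedModule)). now apply ex_RInt_cont.
Qed.

Lemma CRInt_plus f g a b : ccont f -> ccont g ->
  CRInt (fun x => Cplus (f x) (g x)) a b = Cplus (CRInt f a b) (CRInt g a b).
Proof.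
  intros Hf Hg. apply is_RInt_CRInt.
  apply (is_RInt_plus (V:=C_R_NormedModule) f g); now apply CRInt_is_RInt.
Qed.

Lemma CRInt_opp f a b : ccont f ->
  CRInt (fun x => Copp (f x)) a b = Copp (CRInt f a b).
Proof.
  intros Hf. apply is_RInt_CRInt.
  apply (is_RInt_opp (V:=C_R_NormedModule) f); now apply CRInt_is_RInt.
Qed.

Lemma CRInt_minus f g a b : ccont f -> ccont g ->
  CRInt (fun x => Cminus (f x) (g x)) a b = Cminus (CRInt f a b) (CRInt g a b).
Proof.
  intros Hf Hg. unfold Cminus. rewrite CRInt_plus; auto using ccont_opp. now rewrite CRInt_opp.
Qed.

Lemma CRInt_mult c f a b : ccont f ->
  CRInt (fun x => Cmult c (f x)) a b = Cmult c (CRInt f a b).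
Proof.
  intros [f1 f2].
  assert (E1 := ex_RInt_cont _ a b f1). assert (E2 := ex_RInt_cont _ a b f2).
  assert (S : forall (k : R) (g : R -> R), ex_RInt g a b -> RInt (fun t => k * g t) a b = k * RInt g a b).
  { intros k g Hg. apply (RInt_scal (V:=R_CompleteNormedModule) g). exact Hg. }
  assert (S' : forall (k : R) (g : R -> R), ex_RInt g a b -> ex_RInt (fun t => k * g t) a b).
  { intros k g Hg. apply (ex_RInt_scal (V:=R_NormedModule) g). exact Hg. }
  unfold CRInt, Cmult; simpl. f_equal.
  - rewrite <- !S; auto.
    apply (RInt_minus (V:=R_CompleteNormedModule) (fun t => fst c * fst (f t)) (fun t => snd c * snd (f t))); auto.
  - rewrite <- !S; auto.
    apply (RInt_plus (V:=R_CompleteNormedModule) (fun t => fst c * snd (f t)) (fun t => snd c * fst (f t))); auto.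
Qed.

Lemma CRInt_Chasles f a b c : ccont f -> Cplus (CRInt f a b) (CRInt f b c) = CRInt f a c.
Proof.
  intros Hf. symmetry. apply is_RInt_CRInt.
  apply (is_RInt_Chasles (V:=C_R_NormedModule) f a b c); now apply CRInt_is_RInt.
Qed.

Lemma CRInt_ext f g a b : (forall x, f x = g x) -> CRInt f a b = CRInt g a b.
Proof. intros H. unfold CRInt. f_equal; apply RInt_ext; intros; now rewrite H. Qed.

Lemma CRInt_derive (f df : R -> C) a b :
  (forall x, is_derive (fun t => fst (f t)) x (fst (df x))) ->
  (forall x, is_derive (fun t => snd (f t)) x (snd (df x))) ->
  ccont df -> CRInt df a b = Cminus (f b) (f a).
Proof.
  intros H1 H2 [c1 c2]. unfold CRInt.
  rewrite (is_RInt_unique (V:=R_CompleteNormedModule) _ _ _ _ (is_RInt_derive _ _ a b (fun x _ => H1 x) (fun x _ => c1 x))).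
  rewrite (is_RInt_unique (V:=R_CompleteNormedModule) _ _ _ _ (is_RInt_derive _ _ a b (fun x _ => H2 x) (fun x _ => c2 x))).
  reflexivity.
Qed.

Lemma CRInt_fubini f a b c d : ccont2 f ->
  CRInt (fun x => CRInt (fun y => f x y) c d) a b = CRInt (fun y => CRInt (fun x => f x y) a b) c d.
Proof.
  intros H. destruct (ccont2_2d f H). unfold CRInt at 1 3; simpl. f_equal; now apply RInt_fubini.
Qed.

Lemma ccont_CRInt f a b : ccont2 f -> ccont (fun x => CRInt (fun y => f x y) a b).
Proof.
  intros H. destruct (ccont2_2d _ (ccont2_swap f H)).
  split; intros x; simpl.
  - now apply (continuous_RInt_param (fun y x => fst (f x y))).
  - now apply (continuous_RInt_param (fun y x => snd (f x y))).
Qed.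

(** * Improper integrals over the line *)

(** Integrability over the line, recorded in the two forms in which it is used: a common bound for
    all segments, and small integrals over segments far out on either side. *)
Definition majorant (p : R -> R) : Prop :=
  (forall x, continuous p x) /\ (forall x, 0 <= p x) /\
  (exists L, forall a b, a <= b -> RInt p a b <= L) /\
  (forall eps, 0 < eps -> exists M, 0 < M /\
     forall a b, a <= b -> M <= a \/ b <= - M -> RInt p a b <= eps).

(** The two ends move independently, so this is not a principal value. *)
Definition is_CInt (f : R -> C) (l : C) : Prop :=
  forall eps, 0 < eps -> exists M, 0 < M /\
    forall a b, a <= - M -> M <= b -> Cmod (Cminus (CRInt f a b) l) <= eps.

Lemma Cmod_minus_sym (x y : C) : Cmod (Cminus x y) = Cmod (Cminus y x).
Proof. rewrite <- Cmod_opp. f_equal. ring. Qed.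

Lemma Cmod_triangle_minus (x y z : C) :
  Cmod (Cminus x z) <= Cmod (Cminus x y) + Cmod (Cminus y z).
Proof.
  replace (Cminus x z) with (Cplus (Cminus x y) (Cminus y z)) by ring. apply Cmod_triangle.
Qed.

Lemma Ceq_of_Cmod_le (x y : C) : (forall eps, 0 < eps -> Cmod (Cminus x y) <= eps) -> x = y.
Proof.
  intros H. assert (E : Cminus x y = 0%C).
  { apply Cmod_eq_0. apply Rle_antisym; [|apply Cmod_ge_0].
    apply le_epsilon. intros eps He. rewrite Rplus_0_l. auto. }
  replace x with (Cplus (Cminus x y) y) by ring. rewrite E. ring.
Qed.

Lemma is_CInt_unique f l l' : is_CInt f l -> is_CInt f l' -> l = l'.
Proof.
  intros H H'. apply Ceq_of_Cmod_le. intros eps He.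
  destruct (H (eps / 2)) as [M [HM A]]; [lra|].
  destruct (H' (eps / 2)) as [M' [HM' A']]; [lra|].
  set (N := Rmax M M').
  assert (M <= N) by apply Rmax_l. assert (M' <= N) by apply Rmax_r.
  specialize (A (- N) N ltac:(lra) ltac:(lra)). specialize (A' (- N) N ltac:(lra) ltac:(lra)).
  eapply Rle_trans; [apply (Cmod_triangle_minus _ (CRInt f (- N) N))|].
  rewrite (Cmod_minus_sym l). lra.
Qed.

Lemma is_CInt_ext f g l : (forall x, f x = g x) -> is_CInt f l -> is_CInt g l.
Proof. intros H. replace g with f; auto. now apply functional_extensionality. Qed.

Lemma is_CInt_plus f g l m : ccont f -> ccont g -> is_CInt f l -> is_CInt g m ->
  is_CInt (fun x => Cplus (f x) (g x)) (Cplus l m).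
Proof.
  intros Cf Cg H H' eps He.
  destruct (H (eps / 2)) as [M [HM A]]; [lra|].
  destruct (H' (eps / 2)) as [M' [HM' A']]; [lra|].
  exists (Rmax M M'). assert (M <= Rmax M M') by apply Rmax_l.
  assert (M' <= Rmax M M') by apply Rmax_r.
  split; [lra|]. intros a b Ha Hb. rewrite CRInt_plus; auto.
  specialize (A a b ltac:(lra) ltac:(lra)). specialize (A' a b ltac:(lra) ltac:(lra)).
  replace (Cminus _ _) with (Cplus (Cminus (CRInt f a b) l) (Cminus (CRInt g a b) m)) by ring.
  eapply Rle_trans; [apply Cmod_triangle|]. lra.
Qed.

Lemma is_CInt_mult c f l : ccont f -> is_CInt f l -> is_CInt (fun x => Cmult c (f x)) (Cmult c l).
Proof.
  intros Cf H eps He.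
  assert (Hc : 0 < Cmod c + 1) by (generalize (Cmod_ge_0 c); lra).
  destruct (H (eps / (Cmod c + 1))) as [M [HM A]].
  { now apply Rdiv_lt_0_compat. }
  exists M. split; auto. intros a b Ha Hb. rewrite CRInt_mult; auto.
  replace (Cminus _ _) with (Cmult c (Cminus (CRInt f a b) l)) by ring.
  rewrite Cmod_mult. specialize (A a b Ha Hb).
  apply Rle_trans with ((Cmod c + 1) * (eps / (Cmod c + 1))).
  - apply Rmult_le_compat; auto using Cmod_ge_0. lra.
  - right. field. lra.
Qed.

Lemma is_CInt_minus f g l m : ccont f -> ccont g -> is_CInt f l -> is_CInt g m ->
  is_CInt (fun x => Cminus (f x) (g x)) (Cminus l m).
Proof.
  intros Cf Cg H H'.
  replace (Cminus l m) with (Cplus l (Cmult (Copp 1) m)) by ring.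
  apply is_CInt_ext with (fun x => Cplus (f x) (Cmult (Copp 1) (g x))); [intros; ring|].
  apply is_CInt_plus; auto using is_CInt_mult. apply ccont_mult; auto using ccont_const.
Qed.

Lemma is_CInt_bound f p l L : ccont f -> (forall x, continuous p x) ->
  (forall x, Cmod (f x) <= p x) -> (forall a b, a <= b -> RInt p a b <= L) ->
  is_CInt f l -> Cmod l <= L.
Proof.
  intros Cf Cp Hfp HL H. apply le_epsilon. intros eps He.
  destruct (H eps He) as [M [HM A]]. specialize (A (- M) M ltac:(lra) ltac:(lra)).
  replace l with (Cminus (CRInt f (- M) M) (Cminus (CRInt f (- M) M) l)) by ring.
  unfold Cminus at 1. eapply Rle_trans; [apply Cmod_triangle|]. rewrite Cmod_opp.
  apply Rplus_le_compat; auto.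
  eapply Rle_trans; [apply CRInt_norm with (p := p); auto; lra|]. apply HL; lra.
Qed.

Lemma RInt_scal_R (p : R -> R) k a b : (forall x, continuous p x) ->
  RInt (fun x => k * p x) a b = k * RInt p a b.
Proof.
  intros H. apply (RInt_scal (V:=R_CompleteNormedModule) p). now apply ex_RInt_cont.
Qed.

Lemma continuous_scal_R {U : UniformSpace} (p : U -> R) k x : continuous p x -> continuous (fun x => k * p x) x.
Proof. intros H. apply (continuous_mult (K:=R_AbsRing)); auto. apply continuous_const. Qed.

Lemma majorant_scal p k : 0 <= k -> majorant p -> majorant (fun x => k * p x).
Proof.
  intros Hk [Cp [Pp [[L HL] HT]]]. split; [|split; [|split]].
  - intros x. now apply continuous_scal_R.
  - intros x. now apply Rmult_le_pos.
  - exists (k * L). intros a b Hab. rewrite RInt_scal_R; auto. apply Rmult_le_compat_l; auto.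
  - intros eps He. destruct (HT (eps / (k + 1))) as [M [HM A]].
    { apply Rdiv_lt_0_compat; lra. }
    exists M. split; auto. intros a b Hab H. rewrite RInt_scal_R; auto.
    apply Rle_trans with (k * (eps / (k + 1))).
    + apply Rmult_le_compat_l; auto.
    + apply Rle_trans with ((k + 1) * (eps / (k + 1))); [|right; field; lra].
      apply Rmult_le_compat_r; [|lra]. left. apply Rdiv_lt_0_compat; lra.
Qed.

(** Enlarging the segment adds one piece on each side, and each costs at most [k * eps]. This is the
    Cauchy criterion behind the existence of integrals. *)
Lemma CRInt_ext_bound f p k M eps a b a' b' : ccont f -> (forall x, continuous p x) -> 0 <= k ->
  (forall x, Cmod (f x) <= k * p x) ->
  (forall a b, a <= b -> M <= a \/ b <= - M -> RInt p a b <= eps) ->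
  a' <= a -> a <= - M -> M <= b -> b <= b' ->
  Cmod (Cminus (CRInt f a b) (CRInt f a' b')) <= 2 * k * eps.
Proof.
  intros Cf Cp Hk Hf HT H1 H2 H3 H4.
  rewrite <- (CRInt_Chasles f a' a b'), <- (CRInt_Chasles f a b b'); auto.
  replace (Cminus _ _) with (Cplus (Copp (CRInt f a' a)) (Copp (CRInt f b b'))) by ring.
  eapply Rle_trans; [apply Cmod_triangle|]. rewrite !Cmod_opp.
  assert (B : forall u v, u <= v -> M <= u \/ v <= - M -> Cmod (CRInt f u v) <= k * eps).
  { intros u v Huv D. eapply Rle_trans; [apply CRInt_norm with (p := fun x => k * p x); auto|].
    - intros; now apply continuous_scal_R.
    - rewrite RInt_scal_R; auto. apply Rmult_le_compat_l; auto. }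
  assert (B1 := B a' a H1 (or_intror H2)). assert (B2 := B b b' H4 (or_introl H3)). lra.
Qed.

(** The cut-off [M] depends on [p] alone and [f] enters only through the factor [k]; this uniformity
    is what carries continuity in a parameter and the exchange of integrals. *)
Lemma is_CInt_tail f p k M eps l a b : ccont f -> (forall x, continuous p x) -> 0 <= k ->
  (forall x, Cmod (f x) <= k * p x) ->
  (forall a b, a <= b -> M <= a \/ b <= - M -> RInt p a b <= eps) ->
  is_CInt f l -> a <= - M -> M <= b ->
  Cmod (Cminus (CRInt f a b) l) <= 2 * k * eps.
Proof.
  intros Cf Cp Hk Hf HT H Ha Hb. apply le_epsilon. intros eta Heta.
  destruct (H eta Heta) as [N [HN A]].
  set (a' := Rmin a (- N)). set (b' := Rmax b N).
  assert (a' <= a) by apply Rmin_l. assert (a' <= - N) by apply Rmin_r.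
  assert (b <= b') by apply Rmax_l. assert (N <= b') by apply Rmax_r.
  specialize (A a' b' ltac:(lra) ltac:(lra)).
  assert (B := CRInt_ext_bound f p k M eps a b a' b' Cf Cp Hk Hf HT).
  specialize (B ltac:(lra) ltac:(lra) ltac:(lra) ltac:(lra)).
  eapply Rle_trans; [apply (Cmod_triangle_minus _ (CRInt f a' b'))|]. lra.
Qed.

Lemma fst_le_Cmod (z : C) : Rabs (fst z) <= Cmod z.
Proof. eapply Rle_trans; [apply Rmax_l|apply Rmax_Cmod]. Qed.

Lemma snd_le_Cmod (z : C) : Rabs (snd z) <= Cmod z.
Proof. eapply Rle_trans; [apply Rmax_r|apply Rmax_Cmod]. Qed.

Lemma Cmod_le_sum (z : C) : Cmod z <= Rabs (fst z) + Rabs (snd z).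
Proof.
  assert (H1 := Rabs_pos (fst z)). assert (H2 := Rabs_pos (snd z)).
  unfold Cmod. apply Rsqr_incr_0_var; [|lra].
  rewrite Rsqr_sqrt; [|nra].
  rewrite <- (pow2_abs (fst z)), <- (pow2_abs (snd z)). unfold Rsqr. nra.
Qed.

Lemma is_CInt_ex f p : ccont f -> majorant p -> (forall x, Cmod (f x) <= p x) -> exists l, is_CInt f l.
Proof.
  intros Cf [Cp [Pp [_ HT]]] Hf.
  assert (Hf' : forall x, Cmod (f x) <= 1 * p x) by (intros; rewrite Rmult_1_l; auto).
  set (u := fun n => CRInt f (- INR n) (INR n)).
  assert (HC : forall eps : posreal, exists N, forall n m, (N <= n)%nat -> (N <= m)%nat ->
             Cmod (Cminus (u n) (u m)) < eps).
  { intros eps. destruct (HT (eps / 4)) as [M [HM A]]; [generalize (cond_pos eps); lra|].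
    destruct (nfloor_ex M) as [N HN]; [lra|]. exists (S N).
    assert (B : forall n m, (S N <= n)%nat -> (n <= m)%nat -> Cmod (Cminus (u n) (u m)) < eps).
    { intros n m Hn Hm.
      assert (INR (S N) <= INR n) by now apply le_INR.
      assert (INR n <= INR m) by now apply le_INR.
      rewrite S_INR in H.
      eapply Rle_lt_trans.
      - apply (CRInt_ext_bound f p 1 M (eps / 4)); auto; lra.
      - generalize (cond_pos eps); lra. }
    intros n m Hn Hm. destruct (Nat.le_ge_cases n m); auto. rewrite Cmod_minus_sym; auto. }
  assert (E1 : ex_finite_lim_seq (fun n => fst (u n))).
  { apply ex_lim_seq_cauchy_corr. intros eps. destruct (HC eps) as [N HN]. exists N.
    intros n m Hn Hm. eapply Rle_lt_trans; [|apply (HN n m Hn Hm)].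
    apply (fst_le_Cmod (Cminus (u n) (u m))). }
  assert (E2 : ex_finite_lim_seq (fun n => snd (u n))).
  { apply ex_lim_seq_cauchy_corr. intros eps. destruct (HC eps) as [N HN]. exists N.
    intros n m Hn Hm. eapply Rle_lt_trans; [|apply (HN n m Hn Hm)].
    apply (snd_le_Cmod (Cminus (u n) (u m))). }
  destruct E1 as [l1 E1]. destruct E2 as [l2 E2].
  exists (l1, l2). intros eps He. destruct (HT (eps / 4)) as [M [HM A]]; [lra|].
  exists M. split; auto. intros a b Ha Hb.
  assert (He' : 0 < eps / 4) by lra.
  apply is_lim_seq_spec in E1. apply is_lim_seq_spec in E2.
  destruct (E1 (mkposreal _ He')) as [N1 F1]. destruct (E2 (mkposreal _ He')) as [N2 F2].
  destruct (nfloor_ex (Rmax (- a) b)) as [N3 HN3].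
  { apply Rle_trans with b; [lra|apply Rmax_r]. }
  assert (- a <= Rmax (- a) b) by apply Rmax_l. assert (b <= Rmax (- a) b) by apply Rmax_r.
  (* [n] lies past both convergence indices and past [- a] and [b]. Enlarging the segment from [a],
     [b] to [- n], [n] costs [eps / 2], and each component of the limit costs [eps / 4]. *)
  set (n := (N1 + N2 + S N3)%nat).
  assert (INR (S N3) <= INR n) by (apply le_INR; unfold n; lia). rewrite S_INR in H1.
  specialize (F1 n ltac:(unfold n; lia)). specialize (F2 n ltac:(unfold n; lia)).
  change (Rabs (fst (u n) - l1) < eps / 4) in F1.
  change (Rabs (snd (u n) - l2) < eps / 4) in F2.
  eapply Rle_trans; [apply (Cmod_triangle_minus _ (u n))|].
  assert (B := CRInt_ext_bound f p 1 M (eps / 4) a b (- INR n) (INR n) Cf Cp Rle_0_1 Hf' A).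
  specialize (B ltac:(lra) ltac:(lra) ltac:(lra) ltac:(lra)). fold (u n) in B.
  assert (D := Cmod_le_sum (Cminus (u n) (l1, l2))).
  change (fst (Cminus (u n) (l1, l2))) with (fst (u n) - l1) in D.
  change (snd (Cminus (u n) (l1, l2))) with (snd (u n) - l2) in D.
  lra.
Qed.

Lemma ccont_is_CInt f p q X : ccont2 f -> majorant p -> majorant q ->
  (forall x y, Cmod (f x y) <= p x * q y) ->
  (forall x, is_CInt (fun y => f x y) (X x)) -> ccont X.
Proof.
  intros Cf [Cp [Pp _]] [Cq [Pq [_ Tq]]] Hf HX.
  assert (K : forall x0 eps, 0 < eps -> locally x0 (fun x => Cmod (Cminus (X x) (X x0)) < eps)).
  { intros x0 eps He.
    (* [k] bounds [p] near [x0], so one cut-off serves a whole neighbourhood. The two truncations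
       cost [eps / 4] each, the variation of the truncated integral [eps / 2]. *)
    set (k := p x0 + 1). assert (Hk : 0 < k) by (unfold k; generalize (Pp x0); lra).
    destruct (Tq (eps / (8 * k))) as [M [HM A]]; [apply Rdiv_lt_0_compat; lra|].
    assert (C1 := ccont_CRInt f (- M) M Cf).
    assert (C2 := ccont_Cmod _ x0 (ccont_minus _ _ C1 (ccont_const (CRInt (fun y => f x0 y) (- M) M)))).
    assert (L1 : locally x0 (fun x => p x < k)).
    { apply (Cp x0 (fun y => y < k)). apply (open_lt k). unfold k; lra. }
    assert (L2 : locally x0 (fun x => Cmod (Cminus (CRInt (fun y => f x y) (- M) M)
              (CRInt (fun y => f x0 y) (- M) M)) < eps / 2)).
    { apply (C2 (fun y => y < eps / 2)). apply (open_lt (eps / 2)).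
      replace (Cminus _ _) with (RtoC 0) by ring. rewrite Cmod_0. lra. }
    generalize (filter_and _ _ L1 L2). apply filter_imp. intros x [B1 B2].
    assert (T : forall x, p x < k -> Cmod (Cminus (CRInt (fun y => f x y) (- M) M) (X x)) <= eps / 4).
    { intros z Hz.
      replace (eps / 4) with (2 * k * (eps / (8 * k))) by (field; lra).
      apply (is_CInt_tail (fun y => f z y) q k M); auto; try lra.
      - now apply ccont2_r.
      - intros y. eapply Rle_trans; [apply Hf|]. apply Rmult_le_compat_r; auto. lra. }
    assert (T1 := T x B1). assert (T2 := T x0 ltac:(unfold k; lra)).
    rewrite Cmod_minus_sym in T1.
    eapply Rle_lt_trans; [apply (Cmod_triangle_minus _ (CRInt (fun y => f x y) (- M) M))|].
    assert (T3 := Cmod_triangle_minus (CRInt (fun y => f x y) (- M) M) (CRInt (fun y => f x0 y) (- M) M) (X x0)).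
    lra. }
  split; intros x0; apply continuity_pt_filterlim; apply continuity_pt_locally; intros eps;
  generalize (K x0 eps (cond_pos eps)); apply filter_imp; intros x Hx;
  (eapply Rle_lt_trans; [|apply Hx]).
  - apply (fst_le_Cmod (Cminus (X x) (X x0))).
  - apply (snd_le_Cmod (Cminus (X x) (X x0))).
Qed.

(** Truncating the inner integrals costs at most [2 * eta * p x] for [X] and [2 * eta * q y] for
    [Y]; integrated, these errors are still multiples of [eta]. Between the two truncations the
    exchange takes place on a rectangle. *)
Lemma is_CInt_fubini f p q X Y l : ccont2 f -> majorant p -> majorant q ->
  (forall x y, Cmod (f x y) <= p x * q y) ->
  (forall x, is_CInt (fun y => f x y) (X x)) -> (forall y, is_CInt (fun x => f x y) (Y y)) ->
  is_CInt X l -> is_CInt Y l.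
Proof.
  intros Cf Mp Mq Hf HX HY HXl.
  assert (CX := ccont_is_CInt f p q X Cf Mp Mq Hf HX).
  assert (CY : ccont Y).
  { apply (ccont_is_CInt (fun y x => f x y) q p Y); auto using ccont2_swap.
    intros; rewrite Rmult_comm; auto. }
  assert (C1 := fun a b => ccont_CRInt f a b Cf).
  assert (C2 := fun a b => ccont_CRInt _ a b (ccont2_swap _ Cf)).
  destruct Mp as [Cp [Pp [[Lp Bp] Tp]]]. destruct Mq as [Cq [Pq [[Lq Bq] Tq]]].
  assert (0 <= Lp) by (generalize (Bp 0 0 (Rle_refl 0)); rewrite RInt_point; auto).
  assert (0 <= Lq) by (generalize (Bq 0 0 (Rle_refl 0)); rewrite RInt_point; auto).
  intros eps He.
  (* The denominator collects the errors [2 * eta * Lp], [2 * eta * Lq] and the [eta] from the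
     convergence of [X]. *)
  set (eta := eps / (2 * Lp + 2 * Lq + 1)).
  assert (Heta : 0 < eta) by (apply Rdiv_lt_0_compat; lra).
  destruct (Tp eta Heta) as [Mp [HMp Ap]]. destruct (Tq eta Heta) as [Mq [HMq Aq]].
  destruct (HXl eta Heta) as [M [HM A]].
  (* The range of [y] only has to pass the tail threshold of [q]; the auxiliary range of [x] is
     chosen as large as needed. *)
  exists Mq. split; auto. intros c d Hc Hd.
  set (N := Rmax M Mp). assert (M <= N) by apply Rmax_l. assert (Mp <= N) by apply Rmax_r.
  specialize (A (- N) N ltac:(lra) ltac:(lra)).
  assert (D1 : Cmod (Cminus (CRInt X (- N) N) (CRInt (fun x => CRInt (fun y => f x y) c d) (- N) N)) <= 2 * eta * Lp).
  { rewrite <- CRInt_minus; auto.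
    eapply Rle_trans; [apply (CRInt_norm _ (fun x => 2 * eta * p x))|].
    - apply ccont_minus; auto.
    - intros; apply continuous_scal_R; auto.
    - lra.
    - intros x _. rewrite Cmod_minus_sym.
      replace (2 * eta * p x) with (2 * p x * eta) by ring.
      apply (is_CInt_tail (fun y => f x y) q (p x) Mq); auto. now apply ccont2_r.
    - rewrite RInt_scal_R; auto. apply Rmult_le_compat_l; [lra|]. apply Bp; lra. }
  assert (D2 : Cmod (Cminus (CRInt Y c d) (CRInt (fun y => CRInt (fun x => f x y) (- N) N) c d)) <= 2 * eta * Lq).
  { rewrite <- CRInt_minus; auto.
    eapply Rle_trans; [apply (CRInt_norm _ (fun x => 2 * eta * q x))|].
    - apply ccont_minus; auto.
    - intros; apply continuous_scal_R; auto.
    - lra.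
    - intros y _. rewrite Cmod_minus_sym.
      replace (2 * eta * q y) with (2 * q y * eta) by ring.
      apply (is_CInt_tail (fun x => f x y) p (q y) Mp); auto; try lra. now apply ccont2_l.
      intros x. rewrite Rmult_comm. auto.
    - rewrite RInt_scal_R; auto. apply Rmult_le_compat_l; [lra|]. apply Bq; lra. }
  rewrite <- CRInt_fubini in D2; auto.
  set (Z := CRInt (fun x => CRInt (fun y => f x y) c d) (- N) N) in *.
  rewrite Cmod_minus_sym in D1.
  apply Rle_trans with (2 * eta * Lq + 2 * eta * Lp + eta).
  - assert (T1 := Cmod_triangle_minus (CRInt Y c d) Z l).
    assert (T2 := Cmod_triangle_minus Z (CRInt X (- N) N) l). lra.
  - right. unfold eta. field. lra.
Qed.

(** * Exponential majorants and complex derivatives *)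

Lemma RInt_FTC (F f : R -> R) a b : (forall x, is_derive F x (f x)) ->
  (forall x, continuous f x) -> RInt f a b = F b - F a.
Proof.
  intros HF Hf. apply (is_RInt_unique (V:=R_CompleteNormedModule)).
  apply (is_RInt_derive (V:=R_CompleteNormedModule) F f); auto.
Qed.

Lemma continuous_ex_derive (f : R -> R) (x : R) : ex_derive f x -> continuous f x.
Proof. intros H. apply (ex_derive_continuous (K:=R_AbsRing) (V:=R_NormedModule) f x H). Qed.

(** Half the hyperbolic secant of [d * v]: a smooth substitute for the decay exp (- d |v|), with the
    elementary antiderivative [atan (exp (d * v)) / d]. *)
Definition sech (d v : R) : R := / (exp (d * v) + exp (- (d * v))).

Lemma continuous_sech d x : continuous (sech d) x.
Proof.
  apply (continuous_ex_derive (sech d)). unfold sech. auto_derive.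
  generalize (exp_pos (d * x)) (exp_pos (- (d * x))); lra.
Qed.

Lemma sech_pos d x : 0 < sech d x.
Proof.
  apply Rinv_0_lt_compat. generalize (exp_pos (d * x)) (exp_pos (- (d * x))); lra.
Qed.

Lemma sech_le_l d x : sech d x <= exp (d * x).
Proof.
  unfold sech. apply Rle_trans with (/ exp (- (d * x))).
  - apply Rinv_le_contravar; [apply exp_pos|]. generalize (exp_pos (d * x)); lra.
  - right. now rewrite exp_Ropp, Rinv_inv.
Qed.

Lemma sech_le_r d x : sech d x <= exp (- (d * x)).
Proof.
  unfold sech. rewrite (exp_Ropp (d * x)) at 2. apply Rinv_le_contravar; [apply exp_pos|].
  generalize (exp_pos (- (d * x))); lra.
Qed.

Lemma exp_neg_small d eps : 0 < d -> 0 < eps -> exists M, 0 < M /\ exp (- (d * M)) <= eps.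
Proof.
  (* With this witness [d * M] is [/ eps], and the exponential of [/ eps] exceeds [/ eps]. *)
  intros Hd He. exists (/ (d * eps)).
  assert (0 < d * eps) by now apply Rmult_lt_0_compat.
  split; [now apply Rinv_0_lt_compat|].
  rewrite exp_Ropp. apply Rle_trans with (/ / eps); [|now rewrite Rinv_inv; right].
  apply Rinv_le_contravar.
  - now apply Rinv_0_lt_compat.
  - replace (d * / (d * eps)) with (/ eps) by (field; lra).
    generalize (exp_ineq1_le (/ eps)). lra.
Qed.

Lemma exp_le_compat x y : x <= y -> exp x <= exp y.
Proof. intros [H|H]; [left; now apply exp_increasing | right; now rewrite H]. Qed.

Lemma majorant_sech d : 0 < d -> majorant (sech d).
Proof.
  intros Hd. split; [|split; [|split]].
  - apply continuous_sech.
  - intros x. left. apply sech_pos.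
  - exists (PI / d). intros a b Hab.
    rewrite (RInt_FTC (fun x => atan (exp (d * x)) / d)).
    + generalize (atan_bound (exp (d * a))) (atan_bound (exp (d * b))).
      intros H1 H2. replace (_ - _) with ((atan (exp (d * b)) - atan (exp (d * a))) / d) by (field; lra).
      apply Rmult_le_compat_r; [left; now apply Rinv_0_lt_compat|]. lra.
    + intros x. unfold sech. auto_derive; auto. rewrite exp_Ropp.
      assert (H := exp_pos (d * x)). field. split; [lra|split;[|lra]]; nra.
    + apply continuous_sech.
  - intros eps He. destruct (exp_neg_small d (eps * d)) as [M [HM A]]; auto.
    { now apply Rmult_lt_0_compat. }
    exists M. split; auto. intros a b Hab H.
    assert (B : exp (- (d * M)) / d <= eps).
    { apply Rmult_le_reg_r with d; auto. unfold Rdiv. rewrite Rmult_assoc, Rinv_l; lra. }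
    destruct H as [H|H].
    + apply Rle_trans with (RInt (fun x => exp (- (d * x))) a b).
      * apply RInt_le; auto.
        -- apply ex_RInt_cont, continuous_sech.
        -- apply ex_RInt_cont. intros x. apply (continuous_ex_derive (fun x => exp (- (d * x)))). auto_derive; auto.
        -- intros x _. apply sech_le_r.
      * rewrite (RInt_FTC (fun x => - exp (- (d * x)) / d)).
        -- eapply Rle_trans; [|apply B].
           replace (_ - _) with ((exp (- (d * a)) - exp (- (d * b))) / d) by (field; lra).
           apply Rmult_le_compat_r; [left; now apply Rinv_0_lt_compat|].
           assert (exp (- (d * a)) <= exp (- (d * M))) by (apply exp_le_compat; nra).
           generalize (exp_pos (- (d * b))); lra.
        -- intros x. auto_derive; auto. field. lra.
        -- intros x. apply (continuous_ex_derive (fun x => exp (- (d * x)))). auto_derive; auto.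
    + apply Rle_trans with (RInt (fun x => exp (d * x)) a b).
      * apply RInt_le; auto.
        -- apply ex_RInt_cont, continuous_sech.
        -- apply ex_RInt_cont. intros x. apply (continuous_ex_derive (fun x => exp (d * x))). auto_derive; auto.
        -- intros x _. apply sech_le_l.
      * rewrite (RInt_FTC (fun x => exp (d * x) / d)).
        -- eapply Rle_trans; [|apply B].
           replace (_ - _) with ((exp (d * b) - exp (d * a)) / d) by (field; lra).
           apply Rmult_le_compat_r; [left; now apply Rinv_0_lt_compat|].
           assert (exp (d * b) <= exp (- (d * M))) by (apply exp_le_compat; nra).
           generalize (exp_pos (d * a)); lra.
        -- intros x. auto_derive; auto. field. lra.
        -- intros x. apply (continuous_ex_derive (fun x => exp (d * x))). auto_derive; auto.
Qed.

(* The tangent line of [exp] at [ln (2 g / c)] bounds [2 g v - c exp v] from above. *)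
Lemma double_exp_le_sech c g : 0 < c -> 0 < g ->
  exists K, 0 < K /\ forall v, exp (- (c * exp v) + g * v) <= K * sech g v.
Proof.
  intros Hc Hg. set (v0 := ln (2 * g / c)).
  exists (exp (2 * g * (v0 - 1)) + 1). split; [generalize (exp_pos (2 * g * (v0 - 1))); lra|].
  intros v. unfold sech.
  assert (P : 0 < exp (g * v) + exp (- (g * v))).
  { generalize (exp_pos (g * v)) (exp_pos (- (g * v))); lra. }
  apply Rmult_le_reg_r with (exp (g * v) + exp (- (g * v))); auto.
  rewrite Rmult_assoc, Rinv_l, Rmult_1_r; [|lra].
  rewrite Rmult_plus_distr_l, <- !exp_plus.
  apply Rplus_le_compat.
  - apply exp_le_compat.
    assert (E : c * exp v = 2 * g * exp (v - v0)).
    { replace v with (v0 + (v - v0)) at 1 by ring. rewrite exp_plus. unfold v0 at 1.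
      rewrite exp_ln; [field; lra|]. apply Rdiv_lt_0_compat; lra. }
    assert (H := exp_ineq1_le (v - v0)). rewrite E. nra.
  - rewrite <- exp_0. apply exp_le_compat. generalize (Rmult_lt_0_compat _ _ Hc (exp_pos v)). lra.
Qed.

(** * The complex exponential and derivatives along a real parameter *)

Lemma Cexpc_plus (z w : C) : Cexpc (Cplus z w) = Cmult (Cexpc z) (Cexpc w).
Proof.
  unfold Cexpc, Cmult, Cplus; simpl. rewrite exp_plus, cos_plus, sin_plus. f_equal; ring.
Qed.

Lemma Cexpc_0 : Cexpc 0 = 1%C.
Proof. unfold Cexpc; simpl. rewrite exp_0, cos_0, sin_0. unfold RtoC. f_equal; ring. Qed.

Lemma Cmod_Cexpc (z : C) : Cmod (Cexpc z) = exp (fst z).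
Proof.
  unfold Cmod, Cexpc; simpl.
  replace (_ + _) with (exp (fst z) * exp (fst z) * (Rsqr (sin (snd z)) + Rsqr (cos (snd z))))
    by (unfold Rsqr; ring).
  rewrite sin2_cos2, Rmult_1_r. apply sqrt_square. left. apply exp_pos.
Qed.

Lemma Cexpc_R (x : R) : Cexpc (RtoC x) = RtoC (exp x).
Proof. unfold Cexpc, RtoC; simpl. rewrite cos_0, sin_0. f_equal; ring. Qed.

(** Complex functions are differentiated only along real parameters; holomorphy enters through the
    chain rule for [Cexpc]. *)
Definition cderiv (f : R -> C) (x : R) (d : C) : Prop :=
  is_derive (fun t => fst (f t)) x (fst d) /\ is_derive (fun t => snd (f t)) x (snd d).

Lemma cderiv_eq f x d d' : cderiv f x d -> d = d' -> cderiv f x d'.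
Proof. intros H <-. exact H. Qed.

Lemma cderiv_const (c : C) x : cderiv (fun _ => c) x 0.
Proof. split; simpl; apply (is_derive_const (K:=R_AbsRing) (V:=R_NormedModule)). Qed.

Lemma cderiv_RtoC (f : R -> R) x d : is_derive f x d -> cderiv (fun t => RtoC (f t)) x (RtoC d).
Proof. intros H. split; simpl; auto. apply (is_derive_const (K:=R_AbsRing) (V:=R_NormedModule)). Qed.

Lemma cderiv_plus f g x d e : cderiv f x d -> cderiv g x e -> cderiv (fun t => Cplus (f t) (g t)) x (Cplus d e).
Proof.
  intros [f1 f2] [g1 g2]; split; simpl.
  - now apply (is_derive_plus (K:=R_AbsRing) (V:=R_NormedModule) (fun t => fst (f t)) (fun t => fst (g t))).
  - now apply (is_derive_plus (K:=R_AbsRing) (V:=R_NormedModule) (fun t => snd (f t)) (fun t => snd (g t))).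
Qed.

Lemma cderiv_mult f g x d e : cderiv f x d -> cderiv g x e ->
  cderiv (fun t => Cmult (f t) (g t)) x (Cplus (Cmult d (g x)) (Cmult (f x) e)).
Proof.
  intros [f1 f2] [g1 g2].
  assert (M : forall a b (da db : R), is_derive a x da -> is_derive b x db ->
            is_derive (fun t => a t * b t) x (da * b x + a x * db)).
  { intros a b da db Ha Hb. apply (is_derive_mult a b); auto. intros; apply Rmult_comm. }
  split; simpl.
  - replace (_ + _) with ((fst d * fst (g x) + fst (f x) * fst e) - (snd d * snd (g x) + snd (f x) * snd e)) by ring.
    apply (is_derive_minus (K:=R_AbsRing) (V:=R_NormedModule)); now apply M.
  - replace (_ + _) with ((fst d * snd (g x) + fst (f x) * snd e) + (snd d * fst (g x) + snd (f x) * fst e)) by ring.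
    apply (is_derive_plus (K:=R_AbsRing) (V:=R_NormedModule)); now apply M.
Qed.

Lemma cderiv_opp f x d : cderiv f x d -> cderiv (fun t => Copp (f t)) x (Copp d).
Proof.
  intros [f1 f2]; split; simpl.
  - now apply (is_derive_opp (K:=R_AbsRing) (V:=R_NormedModule)).
  - now apply (is_derive_opp (K:=R_AbsRing) (V:=R_NormedModule)).
Qed.

Lemma cderiv_Cexpc f x d : cderiv f x d -> cderiv (fun t => Cexpc (f t)) x (Cmult (Cexpc (f x)) d).
Proof.
  intros [f1 f2].
  assert (M : forall a b (da db : R), is_derive a x da -> is_derive b x db ->
            is_derive (fun t => a t * b t) x (da * b x + a x * db)).
  { intros a b da db Ha Hb. apply (is_derive_mult a b); auto. intros; apply Rmult_comm. }
  assert (E := is_derive_comp exp _ x _ _ (is_derive_exp _) f1).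
  assert (Co := is_derive_comp cos _ x _ _ (is_derive_cos _) f2).
  assert (Si := is_derive_comp sin _ x _ _ (is_derive_sin _) f2).
  unfold scal in *; simpl in E, Co, Si; unfold mult in *; simpl in E, Co, Si.
  split; unfold Cexpc; simpl.
  - replace (_ - _) with (fst d * exp (fst (f x)) * cos (snd (f x)) + exp (fst (f x)) * (snd d * - sin (snd (f x)))) by ring.
    now apply M.
  - replace (_ + _) with (fst d * exp (fst (f x)) * sin (snd (f x)) + exp (fst (f x)) * (snd d * cos (snd (f x)))) by ring.
    now apply M.
Qed.

Lemma CRInt_cderiv (f df : R -> C) a b : (forall x, cderiv f x (df x)) ->
  ccont df -> CRInt df a b = Cminus (f b) (f a).
Proof. intros H C. apply CRInt_derive; auto; intros x; apply H. Qed.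

(** * The Gamma integral along rotated rays *)

Ltac ccont_tac :=
  repeat lazymatch goal with
    | |- ccont (fun _ => ?c) => apply ccont_const
    | |- ccont (fun u => Cplus _ _) => apply ccont_plus
    | |- ccont (fun u => Cminus _ _) => apply ccont_minus
    | |- ccont (fun u => Copp _) => apply ccont_opp
    | |- ccont (fun u => Cmult _ _) => apply ccont_mult
    | |- ccont (fun u => Cexpc _) => apply ccont_Cexpc
    | |- ccont (fun u => RtoC _) => apply ccont_RtoC
    | |- ccont RtoC => apply (ccont_RtoC (fun u => u))
    | |- ccont (pair ?c) => apply (ccont_pair (fun _ => c) (fun u => u))
    | |- ccont (fun u => (_, _)) => apply ccont_pair
    | |- forall x, continuous (fun _ => ?c) x => intros; apply continuous_const
    | |- forall x, continuous (fun u => u) x => intros; apply continuous_id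
    | |- forall x, continuous (fun u => fst u) x => intros; apply continuous_fst
    | |- forall x, continuous (fun u => snd u) x => intros; apply continuous_snd
    | |- forall x, continuous fst x => intros; apply continuous_fst
    | |- forall x, continuous snd x => intros; apply continuous_snd
    end.

(** Euler's integrand exp (- u) u^(xi - 1) du in the variable w = log u. It is entire in [w], and
    shifting [w] by [z] rotates and dilates the ray of integration. *)
Definition gamma_kernel (xi w : C) : C := Cexpc (Cplus (Copp (Cexpc w)) (Cmult xi w)).

Lemma Cmod_gamma_kernel xi w :
  Cmod (gamma_kernel xi w) = exp (- (exp (fst w) * cos (snd w)) + (fst xi * fst w - snd xi * snd w)).
Proof. unfold gamma_kernel. rewrite Cmod_Cexpc. reflexivity. Qed.

Lemma cderiv_gamma_kernel xi (w : R -> C) x d : cderiv w x d ->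
  cderiv (fun t => gamma_kernel xi (w t)) x (Cmult (Cmult (gamma_kernel xi (w x)) (Cminus xi (Cexpc (w x)))) d).
Proof.
  intros H. eapply cderiv_eq.
  - apply cderiv_Cexpc. apply cderiv_plus.
    + apply cderiv_opp, cderiv_Cexpc, H.
    + apply cderiv_mult; [apply cderiv_const | apply H].
  - unfold gamma_kernel. ring.
Qed.

Lemma ccont_gamma_kernel {U : UniformSpace} xi (w : U -> C) : ccont w -> ccont (fun u => gamma_kernel xi (w u)).
Proof. intros H. unfold gamma_kernel. ccont_tac; auto. Qed.

(** The cosine is even and decreases on [0, pi/2], so the damping along a segment is weakest at its
    far end. *)
Lemma cos_interp_ge y t : Rabs y < PI / 2 -> 0 <= t <= 1 -> cos y <= cos (t * y).
Proof.
  intros Hy Ht.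
  assert (E : forall x, cos x = cos (Rabs x)).
  { intros x. unfold Rabs. destruct Rcase_abs; auto. now rewrite cos_neg. }
  rewrite (E y), (E (t * y)), Rabs_mult, (Rabs_right t) by lra.
  assert (0 <= Rabs y) by apply Rabs_pos. assert (0 < PI) by apply PI_RGT_0.
  apply cos_decr_1; nra.
Qed.

(** On the whole segment from [v] to [v + z] the real part of exp w is at least [c * exp v], and
    [K0] absorbs the factor exp (t xi z). Uniformity in [t] is what makes the short sides of the
    parallelogram vanish. *)
Lemma gamma_kernel_bound xi z : 0 < fst xi -> Rabs (snd z) < PI / 2 ->
  exists K, 0 < K /\ forall v t, 0 <= t <= 1 ->
    Cmod (gamma_kernel xi (Cplus (RtoC v) (Cmult (RtoC t) z))) <= K * sech (fst xi) v.
Proof.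
  intros Hxi Hz.
  assert (Hc : 0 < cos (snd z)).
  { apply Rabs_def2 in Hz. apply cos_gt_0; lra. }
  set (c := exp (- Rabs (fst z)) * cos (snd z)).
  assert (0 < c) by (apply Rmult_lt_0_compat; auto; apply exp_pos).
  destruct (double_exp_le_sech c (fst xi)) as [K [HK B]]; auto.
  set (K0 := exp (Rabs (fst xi * fst z) + Rabs (snd xi * snd z))).
  exists (K0 * K). split; [apply Rmult_lt_0_compat; auto; apply exp_pos|].
  intros v t Ht. rewrite Cmod_gamma_kernel. simpl.
  rewrite Rmult_assoc. eapply Rle_trans; [|apply Rmult_le_compat_l; [left; apply exp_pos|apply B]].
  unfold K0. rewrite <- exp_plus. apply exp_le_compat.
  replace (v + (t * fst z - 0 * snd z)) with (v + t * fst z) by ring.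
  replace (0 + (t * snd z + 0 * fst z)) with (t * snd z) by ring.
  assert (H1 : c * exp v <= exp (v + t * fst z) * cos (t * snd z)).
  { unfold c. rewrite exp_plus.
    assert (cos (snd z) <= cos (t * snd z)) by now apply cos_interp_ge.
    assert (exp (- Rabs (fst z)) <= exp (t * fst z)).
    { apply exp_le_compat. generalize (Rle_abs (- fst z)) (Rabs_pos (fst z)). rewrite Rabs_Ropp. nra. }
    assert (0 < exp v) by apply exp_pos. assert (0 < exp (- Rabs (fst z))) by apply exp_pos.
    replace (exp (- Rabs (fst z)) * cos (snd z) * exp v) with (exp v * (exp (- Rabs (fst z)) * cos (snd z))) by ring.
    rewrite Rmult_assoc. apply Rmult_le_compat_l; [lra|]. apply Rmult_le_compat; lra. }
  assert (A : forall x, Rabs x >= 0 -> t * x <= Rabs x).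
  { intros x Hx. generalize (Rle_abs x). nra. }
  assert (H2 : t * (fst xi * fst z) <= Rabs (fst xi * fst z)) by (apply A, Rle_ge, Rabs_pos).
  assert (H3 : t * (- (snd xi * snd z)) <= Rabs (snd xi * snd z)).
  { rewrite <- Rabs_Ropp. apply A, Rle_ge, Rabs_pos. }
  nra.
Qed.

Lemma is_CInt_gamma_kernel_ex xi z : 0 < fst xi -> Rabs (snd z) < PI / 2 ->
  exists l, is_CInt (fun v => gamma_kernel xi (Cplus (RtoC v) z)) l.
Proof.
  intros Hxi Hz. destruct (gamma_kernel_bound xi z Hxi Hz) as [K [HK B]].
  apply is_CInt_ex with (fun v => K * sech (fst xi) v).
  - apply ccont_gamma_kernel. ccont_tac.
  - apply majorant_scal; [lra|]. now apply majorant_sech.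
  - intros v. replace z with (Cmult 1 z) by ring. apply B. lra.
Qed.

(* Cauchy's theorem on the parallelogram spanned by [a, b] and the segment [0, z]. *)
Lemma gamma_kernel_shift_CRInt xi z a b :
  CRInt (fun v => Cminus (gamma_kernel xi (Cplus (RtoC v) z)) (gamma_kernel xi (RtoC v))) a b =
  Cmult z (CRInt (fun t => Cminus (gamma_kernel xi (Cplus (RtoC b) (Cmult (RtoC t) z)))
                                (gamma_kernel xi (Cplus (RtoC a) (Cmult (RtoC t) z)))) 0 1).
Proof.
  (* [D] is the complex derivative of the kernel. The derivative in [v] is [D] and the derivative in
     [t] is [z] times [D]; this proportionality is the Cauchy-Riemann equation, which Fubini turns
     into Cauchy's theorem. *)
  set (D := fun v t => let w := Cplus (RtoC v) (Cmult (RtoC t) z) in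
               Cmult (gamma_kernel xi w) (Cminus xi (Cexpc w))).
  assert (CD : ccont2 D).
  { unfold ccont2, D. apply ccont_mult; [apply ccont_gamma_kernel|]; ccont_tac. }
  rewrite (CRInt_ext _ (fun t => CRInt (fun v => D v t) a b) 0 1).
  2:{ intros t. symmetry.
      apply (CRInt_cderiv (fun v => gamma_kernel xi (Cplus (RtoC v) (Cmult (RtoC t) z)))).
      - intros v. eapply cderiv_eq.
        + apply cderiv_gamma_kernel. apply cderiv_plus; [|apply cderiv_const].
          apply cderiv_RtoC. apply is_derive_id.
        + unfold D. change (@one R_AbsRing) with 1%R. simpl. ring.
      - now apply ccont2_l. }
  rewrite <- CRInt_fubini; auto.
  rewrite <- CRInt_mult; [|now apply ccont_CRInt].
  apply CRInt_ext. intros v.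
  rewrite <- CRInt_mult; [|now apply ccont2_r].
  rewrite (CRInt_cderiv (fun t => gamma_kernel xi (Cplus (RtoC v) (Cmult (RtoC t) z)))).
  - f_equal; f_equal; ring.
  - intros t. eapply cderiv_eq.
    + apply cderiv_gamma_kernel. apply cderiv_plus; [apply cderiv_const|].
      apply cderiv_mult; [|apply cderiv_const].
      apply cderiv_RtoC. apply is_derive_id.
    + unfold D. change (@one R_AbsRing) with 1%R. ring.
  - apply ccont_mult; [apply ccont_const|]. now apply ccont2_r.
Qed.

(** The integral over the shifted line exists by domination, so it suffices that the difference of
    the two long sides, which equals the contribution of the short ones, tends to 0. *)
Lemma is_CInt_gamma_kernel_shift xi z G : 0 < fst xi -> Rabs (snd z) < PI / 2 ->
  is_CInt (fun v => gamma_kernel xi (RtoC v)) G -> is_CInt (fun v => gamma_kernel xi (Cplus (RtoC v) z)) G.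
Proof.
  intros Hxi Hz HG. destruct (is_CInt_gamma_kernel_ex xi z Hxi Hz) as [l Hl].
  replace G with l; auto.
  assert (C1 : ccont (fun v => gamma_kernel xi (Cplus (RtoC v) z))) by (apply ccont_gamma_kernel; ccont_tac).
  assert (C2 : ccont (fun v => gamma_kernel xi (RtoC v))) by (apply ccont_gamma_kernel; ccont_tac).
  assert (H := is_CInt_minus _ _ _ _ C1 C2 Hl HG).
  enough (H0 : Cminus l G = 0%C).
  { replace l with (Cplus (Cminus l G) G) by ring. rewrite H0. ring. }
  apply (is_CInt_unique _ _ _ H). clear H.
  destruct (gamma_kernel_bound xi z Hxi Hz) as [K [HK B]].
  intros eps He.
  (* The 1 keeps [k] positive when [z] is 0; [2 * K] stands for the two short sides. *)
  set (k := (Cmod z + 1) * (2 * K)).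
  assert (Hk : 0 < k) by (unfold k; generalize (Cmod_ge_0 z); nra).
  destruct (exp_neg_small (fst xi) (eps / k)) as [M [HM A]]; auto.
  { now apply Rdiv_lt_0_compat. }
  exists M. split; auto. intros a b Ha Hb.
  replace (Cminus _ 0) with (CRInt (fun v => Cminus (gamma_kernel xi (Cplus (RtoC v) z)) (gamma_kernel xi (RtoC v))) a b) by ring.
  rewrite gamma_kernel_shift_CRInt, Cmod_mult.
  set (e := exp (- (fst xi * M))) in *.
  assert (Sa : sech (fst xi) a <= e).
  { eapply Rle_trans; [apply sech_le_l|]. apply exp_le_compat. nra. }
  assert (Sb : sech (fst xi) b <= e).
  { eapply Rle_trans; [apply sech_le_r|]. apply exp_le_compat. nra. }
  assert (I : Cmod (CRInt (fun t => Cminus (gamma_kernel xi (Cplus (RtoC b) (Cmult (RtoC t) z)))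
                (gamma_kernel xi (Cplus (RtoC a) (Cmult (RtoC t) z)))) 0 1) <= 2 * K * e).
  { eapply Rle_trans; [apply (CRInt_norm _ (fun _ => 2 * K * e))|].
    - apply ccont_minus; apply ccont_gamma_kernel; ccont_tac.
    - intros; apply continuous_const.
    - lra.
    - intros t Ht. unfold Cminus. eapply Rle_trans; [apply Cmod_triangle|]. rewrite Cmod_opp.
      assert (B1 := B b t Ht). assert (B2 := B a t Ht). nra.
    - rewrite RInt_const. unfold scal; simpl; unfold mult; simpl. lra. }
  apply Rle_trans with ((Cmod z + 1) * (2 * K * (eps / k))).
  - apply Rmult_le_compat; try apply Cmod_ge_0; [lra|]. eapply Rle_trans; [apply I|].
    apply Rmult_le_compat_l; lra.
  - right. unfold k. field. generalize (Cmod_ge_0 z). split; lra.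
Qed.

(** The shifted kernel carries the constant factor exp (xi z); dividing by it leaves the Mellin
    transform of a rotated exponential. *)
Lemma is_CInt_rotate xi z G : 0 < fst xi -> Rabs (snd z) < PI / 2 ->
  is_CInt (fun v => gamma_kernel xi (RtoC v)) G ->
  is_CInt (fun v => Cexpc (Cplus (Copp (Cexpc (Cplus (RtoC v) z))) (Cmult xi (RtoC v))))
      (Cmult (Cexpc (Copp (Cmult xi z))) G).
Proof.
  intros Hxi Hz HG.
  apply is_CInt_ext with (fun v => Cmult (Cexpc (Copp (Cmult xi z))) (gamma_kernel xi (Cplus (RtoC v) z))).
  - intros v. unfold gamma_kernel. rewrite <- Cexpc_plus. f_equal. ring.
  - apply is_CInt_mult; [apply ccont_gamma_kernel; ccont_tac|]. now apply is_CInt_gamma_kernel_shift.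
Qed.

(** * From the line to the generalized integrals of the statement *)

Lemma is_CInt_fst f l eps : is_CInt f l -> 0 < eps -> exists M, 0 < M /\
  forall a b, a <= - M -> M <= b -> Rabs (RInt (fun t => fst (f t)) a b - fst l) < eps.
Proof.
  intros H He. destruct (H (eps / 2)) as [M [HM A]]; [lra|]. exists M. split; auto.
  intros a b Ha Hb. specialize (A a b Ha Hb).
  assert (B := fst_le_Cmod (Cminus (CRInt f a b) l)).
  change (fst (Cminus (CRInt f a b) l)) with (RInt (fun t => fst (f t)) a b - fst l) in B. lra.
Qed.

Lemma is_CInt_snd f l eps : is_CInt f l -> 0 < eps -> exists M, 0 < M /\
  forall a b, a <= - M -> M <= b -> Rabs (RInt (fun t => snd (f t)) a b - snd l) < eps.
Proof.
  intros H He. destruct (H (eps / 2)) as [M [HM A]]; [lra|]. exists M. split; auto.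
  intros a b Ha Hb. specialize (A a b Ha Hb).
  assert (B := snd_le_Cmod (Cminus (CRInt f a b) l)).
  change (snd (Cminus (CRInt f a b) l)) with (RInt (fun t => snd (f t)) a b - snd l) in B. lra.
Qed.

Lemma is_RInt_gen_line (f : R -> R) (l : R) : (forall x, continuous f x) ->
  (forall eps, 0 < eps -> exists M, 0 < M /\
     forall a b, a <= - M -> M <= b -> Rabs (RInt f a b - l) < eps) ->
  is_RInt_gen f (Rbar_locally m_infty) (Rbar_locally p_infty) l.
Proof.
  intros Hf H. apply filterlimi_locally. intros eps.
  destruct (H eps (cond_pos eps)) as [M [HM A]].
  apply (Filter_prod _ _ _ (fun a => a < - M) (fun b => M < b)).
  - exists (- M). auto.
  - exists M. auto.
  - intros a b Ha Hb. exists (RInt f a b). split.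
    + apply (RInt_correct (V:=R_CompleteNormedModule)). now apply ex_RInt_cont.
    + apply A; lra.
Qed.

Lemma CIntR_eq f l : ccont f -> is_CInt f l -> CIntR f = l.
Proof.
  intros [C1 C2] H. unfold CIntR, CInt_gen. rewrite (surjective_pairing l). f_equal.
  - apply (is_RInt_gen_unique (V:=R_CompleteNormedModule)).
    apply is_RInt_gen_line; auto. intros; now apply is_CInt_fst.
  - apply (is_RInt_gen_unique (V:=R_CompleteNormedModule)).
    apply is_RInt_gen_line; auto. intros; now apply is_CInt_snd.
Qed.

(** Substitution x = exp (k v). The rate [k] is left free because Euler's integral uses 1 and the
    distances use 1/2, which makes the squared distance exp v. Continuity is asked on the open
    half-line only, as Euler's integrand may be singular at 0. *)
Lemma is_RInt_gen_halfline (f : R -> R) (k l : R) : 0 < k ->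
  (forall x, 0 < x -> continuous f x) ->
  (forall eps, 0 < eps -> exists M, 0 < M /\
     forall a b, a <= - M -> M <= b ->
       Rabs (RInt (fun v => k * exp (k * v) * f (exp (k * v))) a b - l) < eps) ->
  is_RInt_gen f (at_right 0) (Rbar_locally p_infty) l.
Proof.
  intros Hk Hf H. apply filterlimi_locally. intros eps.
  destruct (H eps (cond_pos eps)) as [M [HM A]].
  apply (Filter_prod _ _ _ (fun a => 0 < a < exp (- (k * M))) (fun b => exp (k * M) < b)).
  - exists (mkposreal _ (exp_pos (- (k * M)))). simpl. intros y Hy Hy0.
    split; auto. change (Rabs (y - 0) < exp (- (k * M))) in Hy.
    rewrite Rminus_0_r, Rabs_right in Hy; lra.
  - exists (exp (k * M)). auto.
  - intros a b Ha Hb. simpl. assert (Hb0 := exp_pos (k * M)).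
    assert (Hkk : 0 < / k) by now apply Rinv_0_lt_compat.
    assert (Hla : ln a / k <= - M).
    { apply Rmult_le_reg_r with k; auto. unfold Rdiv. rewrite Rmult_assoc, Rinv_l, Rmult_1_r by lra.
      left. rewrite <- (ln_exp (- M * k)). apply ln_increasing; [lra|].
      replace (- M * k) with (- (k * M)) by ring. lra. }
    assert (Hlb : M <= ln b / k).
    { apply Rmult_le_reg_r with k; auto. unfold Rdiv. rewrite Rmult_assoc, Rinv_l, Rmult_1_r by lra.
      left. rewrite <- (ln_exp (M * k)). apply ln_increasing; [apply exp_pos|].
      replace (M * k) with (k * M) by ring. lra. }
    exists (RInt f a b).
    assert (E : RInt (fun v => k * exp (k * v) * f (exp (k * v))) (ln a / k) (ln b / k) = RInt f a b).
    { assert (E := RInt_comp (V:=R_CompleteNormedModule) f (fun v => exp (k * v)) (fun v => k * exp (k * v)) (ln a / k) (ln b / k)).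
      cbv beta in E. replace (k * (ln a / k)) with (ln a) in E by (field; lra).
      replace (k * (ln b / k)) with (ln b) in E by (field; lra).
      rewrite !exp_ln in E by lra. apply E.
      - intros x _. apply Hf, exp_pos.
      - intros x _. split.
        + auto_derive; auto. ring.
        + apply (continuous_ex_derive (fun v => k * exp (k * v))). auto_derive; auto. }
    split.
    + apply (RInt_correct (V:=R_CompleteNormedModule)).
      apply (ex_RInt_continuous (V:=R_CompleteNormedModule)).
      intros x Hx. apply Hf.
      assert (0 < Rmin a b) by (apply Rmin_glb_lt; lra). lra.
    + rewrite <- E. apply A; auto.
Qed.

Lemma CInt0inf_eq f k l : 0 < k ->
  (forall x, 0 < x -> continuous (fun t => fst (f t)) x) ->
  (forall x, 0 < x -> continuous (fun t => snd (f t)) x) ->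
  is_CInt (fun v => Cmult (RtoC (k * exp (k * v))) (f (exp (k * v)))) l -> CInt0inf f = l.
Proof.
  intros Hk C1 C2 H. unfold CInt0inf, CInt_gen. rewrite (surjective_pairing l). f_equal.
  - apply (is_RInt_gen_unique (V:=R_CompleteNormedModule)).
    apply (is_RInt_gen_halfline _ k); auto. intros eps He.
    destruct (is_CInt_fst _ _ eps H He) as [M [HM A]]. exists M. split; auto.
    intros a b Ha Hb. specialize (A a b Ha Hb).
    rewrite (RInt_ext _ (fun t => fst (Cmult (RtoC (k * exp (k * t))) (f (exp (k * t)))))); auto.
    intros x _. simpl. ring.
  - apply (is_RInt_gen_unique (V:=R_CompleteNormedModule)).
    apply (is_RInt_gen_halfline _ k); auto. intros eps He.
    destruct (is_CInt_snd _ _ eps H He) as [M [HM A]]. exists M. split; auto.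
    intros a b Ha Hb. specialize (A a b Ha Hb).
    rewrite (RInt_ext _ (fun t => snd (Cmult (RtoC (k * exp (k * t))) (f (exp (k * t)))))); auto.
    intros x _. simpl. ring.
Qed.

(** * Principal powers of positive reals and Euler's integral *)

Lemma Clogc_pos (x : R) : 0 < x -> Clogc (RtoC x) = RtoC (ln x).
Proof.
  intros Hx. unfold Clogc. rewrite Cmod_R, Rabs_right by lra. unfold RtoC. f_equal.
  unfold Argc; simpl. destruct (Rlt_dec 0 x); [|lra].
  replace (0 / x) with 0 by (field; lra). apply atan_0.
Qed.

Lemma Cpowc_pos (x : R) w : 0 < x -> Cpowc (RtoC x) w = Cexpc (Cmult w (RtoC (ln x))).
Proof.
  intros Hx. unfold Cpowc. simpl. destruct (Req_EM_T x 0); [lra|]. now rewrite Clogc_pos.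
Qed.

Lemma continuous_ext_pos (f g : R -> R) x : 0 < x -> (forall y, 0 < y -> g y = f y) ->
  continuous g x -> continuous f x.
Proof.
  intros Hx H. apply continuous_ext_loc.
  exists (mkposreal _ Hx). intros y Hy. change (Rabs (y - x) < x) in Hy.
  apply Rabs_def2 in Hy. apply H; lra.
Qed.

Lemma is_CInt_CGamma xi : 0 < fst xi -> is_CInt (fun v => gamma_kernel xi (RtoC v)) (CGamma xi).
Proof.
  intros Hxi.
  (* [CGamma] is built from total operators, whose values are known only once the integral
     converges; convergence is the unshifted case of the kernel. *)
  destruct (is_CInt_gamma_kernel_ex xi (RtoC 0)) as [l Hl]; auto.
  { simpl. rewrite Rabs_R0. generalize PI_RGT_0. lra. }
  apply is_CInt_ext with (g := fun v => gamma_kernel xi (RtoC v)) in Hl; [|intros; now rewrite Cplus_0_r].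
  replace (CGamma xi) with l; auto. symmetry. unfold CGamma.
  assert (CC : forall x, 0 < x -> continuous (fun t => ln t) x).
  { intros x Hx. apply continuous_ex_derive. exists (/ x). now apply is_derive_ln. }
  assert (C0 : forall x, continuous (fun t => exp (- t)) x).
  { intros x. apply (continuous_ex_derive (fun t => exp (- t))). auto_derive; auto. }
  apply CInt0inf_eq with 1; [lra| | |].
  - intros x Hx. simpl. apply (continuous_ext_pos _ (fun t => exp (- t) * (exp ((fst xi - 1) * ln t) * cos (snd xi * ln t)))); auto.
    { intros y Hy. rewrite Cpowc_pos; auto. unfold Cexpc; simpl.
      replace ((fst xi + - (1)) * ln y - (snd xi + - 0) * 0) with ((fst xi - 1) * ln y) by ring.
      replace ((fst xi + - (1)) * 0 + (snd xi + - 0) * ln y) with (snd xi * ln y) by ring. ring. }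
    apply continuous_ex_derive. auto_derive. auto.
  - intros x Hx. simpl. apply (continuous_ext_pos _ (fun t => exp (- t) * (exp ((fst xi - 1) * ln t) * sin (snd xi * ln t)))); auto.
    { intros y Hy. rewrite Cpowc_pos; auto. unfold Cexpc; simpl.
      replace ((fst xi + - (1)) * ln y - (snd xi + - 0) * 0) with ((fst xi - 1) * ln y) by ring.
      replace ((fst xi + - (1)) * 0 + (snd xi + - 0) * ln y) with (snd xi * ln y) by ring. ring. }
    apply continuous_ex_derive. auto_derive. auto.
  - revert Hl. apply is_CInt_ext. intros v. rewrite !Rmult_1_l.
    rewrite Cpowc_pos by apply exp_pos. rewrite ln_exp.
    unfold gamma_kernel. rewrite <- !Cexpc_R, <- !Cexpc_plus. f_equal.
    rewrite Cexpc_R, RtoC_opp. ring.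
Qed.

(** * Fourier inversion *)

Lemma continuous_exp_abs {U : UniformSpace} (k : R) (f : U -> R) x : continuous f x ->
  continuous (fun u => exp (k * Rabs (f u))) x.
Proof.
  intros H. apply (continuous_comp (fun u => k * Rabs (f u)) exp); [|apply continuous_exp].
  apply continuous_scal_R. apply (continuous_comp f Rabs); auto. apply continuous_Rabs.
Qed.

Lemma exp_abs_le_sech d t : 0 <= d -> exp (- d * Rabs t) <= 2 * sech d t.
Proof.
  intros Hd. unfold sech.
  assert (P : 0 < exp (d * t) + exp (- (d * t))).
  { generalize (exp_pos (d * t)) (exp_pos (- (d * t))); lra. }
  apply Rmult_le_reg_r with (exp (d * t) + exp (- (d * t))); auto.
  rewrite Rmult_assoc, Rinv_l, Rmult_1_r, Rmult_plus_distr_l, <- !exp_plus; [|lra].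
  assert (H1 := Rle_abs t). assert (H2 := Rle_abs (- t)). rewrite Rabs_Ropp in H2.
  assert (A1 : exp (- d * Rabs t + d * t) <= 1) by (rewrite <- exp_0; apply exp_le_compat; nra).
  assert (A2 : exp (- d * Rabs t + - (d * t)) <= 1) by (rewrite <- exp_0; apply exp_le_compat; nra).
  lra.
Qed.

Lemma sech_le_1 d x : sech d x <= 1.
Proof.
  destruct (Rle_dec 0 (d * x)).
  - eapply Rle_trans; [apply sech_le_r|]. rewrite <- exp_0. apply exp_le_compat. lra.
  - eapply Rle_trans; [apply sech_le_l|]. rewrite <- exp_0. apply exp_le_compat. lra.
Qed.

Lemma CRInt_ext_in f g a b : (forall x, Rmin a b < x < Rmax a b -> f x = g x) -> CRInt f a b = CRInt g a b.
Proof. intros H. unfold CRInt. f_equal; apply RInt_ext; intros; now rewrite H. Qed.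

Lemma CRInt_Cexpc_lin (c : C) a b : c <> 0%C ->
  CRInt (fun t => Cexpc (Cmult c (RtoC t))) a b =
  Cdiv (Cminus (Cexpc (Cmult c (RtoC b))) (Cexpc (Cmult c (RtoC a)))) c.
Proof.
  intros Hc.
  rewrite (CRInt_cderiv (fun t => Cmult (Cexpc (Cmult c (RtoC t))) (Cinv c))).
  - field. auto.
  - intros t. eapply cderiv_eq.
    + apply cderiv_mult; [|apply cderiv_const]. apply cderiv_Cexpc.
      apply cderiv_mult; [apply cderiv_const|]. apply cderiv_RtoC, is_derive_id.
    + change (@one R_AbsRing) with 1%R. cbv beta. field. auto.
  - ccont_tac.
Qed.

Lemma Cmod_Cdiv_le (x y : C) k : y <> 0%C -> Cmod x <= k -> Cmod (Cdiv x y) <= k / Cmod y.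
Proof.
  intros Hy Hx. rewrite Cmod_div; auto. apply Rmult_le_compat_r; auto.
  left. apply Rinv_0_lt_compat. now apply Cmod_gt_0.
Qed.

(** Split at 0, the integrand is a pure exponential on each side, with rates [c1] on the left and
    [c2] on the right; the value is the difference of their inverses. *)
Lemma is_CInt_poisson eps v : 0 < eps ->
  is_CInt (fun t => Cmult (Cexpc (Cmult (0, v) (RtoC t))) (RtoC (exp (- eps * Rabs t))))
      (RtoC (2 * eps / (eps ^ 2 + v ^ 2))).
Proof.
  intros He.
  set (f := fun t => _).
  assert (Cf : ccont f).
  { unfold f. ccont_tac. intros x. apply continuous_exp_abs, continuous_id. }
  set (c1 := (eps, v) : C). set (c2 := (- eps, v) : C).
  assert (N1 : c1 <> 0%C) by (intros E; apply (f_equal fst) in E; simpl in E; lra).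
  assert (N2 : c2 <> 0%C) by (intros E; apply (f_equal fst) in E; simpl in E; lra).
  assert (P1 : 0 < Cmod c1) by now apply Cmod_gt_0.
  assert (P2 : 0 < Cmod c2) by now apply Cmod_gt_0.
  assert (E0 : Cminus (Cinv c1) (Cinv c2) = RtoC (2 * eps / (eps ^ 2 + v ^ 2))).
  { unfold c1, c2, Cinv, Cminus, Copp, Cplus, RtoC; simpl.
    assert (eps * (eps * 1) + v * (v * 1) <> 0) by nra.
    f_equal; field; repeat split; nra. }
  intros eta Heta.
  set (k := / Cmod c1 + / Cmod c2).
  assert (Hk1 : 0 < / Cmod c1) by now apply Rinv_0_lt_compat.
  assert (Hk2 : 0 < / Cmod c2) by now apply Rinv_0_lt_compat.
  destruct (exp_neg_small eps (eta / k)) as [M [HM A]]; auto.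
  { apply Rdiv_lt_0_compat; unfold k; lra. }
  exists M. split; auto. intros a b Ha Hb.
  rewrite <- (CRInt_Chasles f a 0 b); auto.
  rewrite (CRInt_ext_in f (fun t => Cexpc (Cmult c1 (RtoC t))) a 0).
  2:{ intros x Hx. rewrite Rmin_left, Rmax_right in Hx by lra. unfold f.
      rewrite Rabs_left by lra. rewrite <- Cexpc_R, <- Cexpc_plus. f_equal.
      unfold c1, Cmult, Cplus, RtoC; simpl. f_equal; ring. }
  rewrite (CRInt_ext_in f (fun t => Cexpc (Cmult c2 (RtoC t))) 0 b).
  2:{ intros x Hx. rewrite Rmin_left, Rmax_right in Hx by lra. unfold f.
      rewrite Rabs_right by lra. rewrite <- Cexpc_R, <- Cexpc_plus. f_equal.
      unfold c2, Cmult, Cplus, RtoC; simpl. f_equal; ring. }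
  rewrite !CRInt_Cexpc_lin; auto. rewrite !Cmult_0_r, Cexpc_0, <- E0.
  replace (Cminus _ _) with (Cplus (Copp (Cdiv (Cexpc (Cmult c1 (RtoC a))) c1)) (Cdiv (Cexpc (Cmult c2 (RtoC b))) c2))
    by (field; auto).
  eapply Rle_trans; [apply Cmod_triangle|]. rewrite Cmod_opp.
  set (e := exp (- (eps * M))) in *.
  assert (B1 : Cmod (Cdiv (Cexpc (Cmult c1 (RtoC a))) c1) <= e / Cmod c1).
  { apply Cmod_Cdiv_le; auto. rewrite Cmod_Cexpc. apply exp_le_compat. simpl. nra. }
  assert (B2 : Cmod (Cdiv (Cexpc (Cmult c2 (RtoC b))) c2) <= e / Cmod c2).
  { apply Cmod_Cdiv_le; auto. rewrite Cmod_Cexpc. apply exp_le_compat. simpl. nra. }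
  apply Rle_trans with (e * k); [unfold k; lra|].
  apply Rle_trans with (eta / k * k).
  - apply Rmult_le_compat_r; auto. unfold k; lra.
  - right. field. unfold k; lra.
Qed.

Lemma RInt_cauchy_kernel eps a b : 0 < eps ->
  RInt (fun v => 2 * eps / (eps ^ 2 + v ^ 2)) a b = 2 * atan (b / eps) - 2 * atan (a / eps).
Proof.
  intros He. apply (RInt_FTC (fun v => 2 * atan (v / eps))).
  - intros x. auto_derive; auto. field. split; [|lra]. nra.
  - intros x. apply (continuous_ex_derive (fun v => 2 * eps / (eps ^ 2 + v ^ 2))). auto_derive. nra.
Qed.

Lemma continuous_cauchy_kernel eps x : 0 < eps -> continuous (fun v => 2 * eps / (eps ^ 2 + v ^ 2)) x.
Proof.
  intros He. apply (continuous_ex_derive (fun v => 2 * eps / (eps ^ 2 + v ^ 2))). auto_derive. nra.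
Qed.

Lemma CRInt_RtoC (f : R -> R) a b : CRInt (fun t => RtoC (f t)) a b = RtoC (RInt f a b).
Proof.
  unfold CRInt, RtoC; simpl. f_equal. rewrite RInt_const. unfold scal; simpl; unfold mult; simpl. ring.
Qed.

Lemma is_CInt_cauchy_kernel eps : 0 < eps ->
  is_CInt (fun v => RtoC (2 * eps / (eps ^ 2 + v ^ 2))) (RtoC (2 * PI)).
Proof.
  intros He eta Heta.
  (* The bound [PI / 4] keeps [PI / 2 - d] in the interval where [atan] inverts [tan]. *)
  assert (HPI := PI_RGT_0). set (d := Rmin (eta / 4) (PI / 4)).
  assert (d <= eta / 4) by apply Rmin_l. assert (d <= PI / 4) by apply Rmin_r.
  assert (0 < d) by (apply Rmin_glb_lt; lra).
  set (N := tan (PI / 2 - d)).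
  assert (HN : forall x, N < x -> Rabs (atan x - PI / 2) < eta / 4).
  { intros x Hx. apply atan_increasing in Hx. unfold N in Hx. rewrite atan_tan in Hx by lra.
    generalize (atan_bound x). intros. apply Rabs_def1; lra. }
  set (M := (Rmax N 0 + 1) * eps).
  assert (N <= Rmax N 0) by apply Rmax_l. assert (0 <= Rmax N 0) by apply Rmax_r.
  exists M. split; [unfold M; nra|]. intros a b Ha Hb.
  rewrite CRInt_RtoC, RInt_cauchy_kernel; auto.
  rewrite <- RtoC_minus, Cmod_R.
  assert (D : forall x, M <= x -> N < x / eps).
  { intros x Hx. apply Rmult_lt_reg_r with eps; auto. unfold Rdiv. rewrite Rmult_assoc, Rinv_l, Rmult_1_r by lra.
    unfold M in Hx. nra. }
  assert (B1 := HN _ (D b Hb)). assert (B2 := HN (- a / eps) ltac:(apply D; lra)).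
  replace (- a / eps) with (- (a / eps)) in B2 by (field; lra). rewrite atan_opp in B2.
  apply Rabs_def2 in B1. apply Rabs_def2 in B2. apply Rabs_le. lra.
Qed.

(** The phases alone give no decay in [t], so the two integrals cannot be exchanged as they stand.
    With the weight exp (- eps |t|) they can, and the weighted integral of [hh] becomes the integral
    of [h] against a Poisson kernel of mass 2 pi that concentrates at 0 as eps decreases. *)
Lemma fourier_inversion (h hh : R -> C) g K C d : 0 < g -> 0 < d -> 0 <= K -> 0 <= C ->
  ccont h -> (forall v, Cmod (h v) <= K * sech g v) ->
  (forall t, is_CInt (fun v => Cmult (h v) (Cexpc (Cmult (0, v) (RtoC t)))) (hh t)) ->
  (forall t, Cmod (hh t) <= C * exp (- (2 * d) * Rabs t)) ->
  ccont hh /\ is_CInt hh (Cmult (RtoC (2 * PI)) (h 0)).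
Proof.
  intros Hg Hd HK HC Ch Bh Hh Bhh.
  set (f := fun (eps v t : R) => Cmult (Cmult (h v) (Cexpc (Cmult (0, v) (RtoC t)))) (RtoC (exp (- eps * Rabs t)))).
  assert (Cf : forall eps, ccont2 (f eps)).
  { intros eps. unfold ccont2, f. apply ccont_mult; [apply ccont_mult|].
    - apply (ccont_comp h (fun p : R_UniformSpace * R_UniformSpace => fst p)); auto.
      intros [x y]. apply continuous_fst.
    - ccont_tac.
    - apply ccont_RtoC. intros x. apply continuous_exp_abs, continuous_snd. }
  assert (Mp : majorant (fun v => K * sech g v)) by (apply majorant_scal; auto; now apply majorant_sech).
  assert (Mq : forall eps, 0 < eps -> majorant (fun t => 2 * sech eps t)).
  { intros; apply majorant_scal; [lra|]. now apply majorant_sech. }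
  assert (Bf : forall eps v t, 0 < eps -> Cmod (f eps v t) <= K * sech g v * (2 * sech eps t)).
  { intros eps v t He. unfold f. rewrite !Cmod_mult, Cmod_Cexpc, Cmod_R.
    replace (fst _) with 0 by (simpl; ring). rewrite exp_0, Rmult_1_r.
    rewrite Rabs_right by (left; apply exp_pos).
    apply Rmult_le_compat.
    - apply Cmod_ge_0.
    - left; apply exp_pos.
    - apply Bh.
    - apply exp_abs_le_sech; lra. }
  assert (Ie : forall eps t, is_CInt (fun v => f eps v t) (Cmult (RtoC (exp (- eps * Rabs t))) (hh t))).
  { intros eps t.
    apply is_CInt_ext with (fun v => Cmult (RtoC (exp (- eps * Rabs t))) (Cmult (h v) (Cexpc (Cmult (0, v) (RtoC t))))).
    - intros v. unfold f. ring.
    - apply is_CInt_mult; auto. apply ccont_mult; auto. ccont_tac. }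
  assert (Chh : ccont hh).
  (* Continuity of [hh] comes from the weighted integral with eps = 1, the weight being divided out
     afterwards. *)
  { replace hh with (fun t => Cmult (RtoC (exp (1 * Rabs t))) (Cmult (RtoC (exp (- 1 * Rabs t))) (hh t))).
    - apply ccont_mult.
      + apply ccont_RtoC. intros; apply continuous_exp_abs, continuous_id.
      + apply (ccont_is_CInt (fun t v => f 1 v t) (fun t => 2 * sech 1 t) (fun v => K * sech g v)); auto.
        * apply ccont2_swap, Cf.
        * apply Mq; lra.
        * intros t v. rewrite Rmult_comm. apply Bf; lra.
    - apply functional_extensionality. intros t. rewrite Cmult_assoc, <- RtoC_mult, <- exp_plus.
      replace (_ + _) with 0 by ring. rewrite exp_0. ring. }
  split; auto.
  destruct (is_CInt_ex hh (fun t => C * (2 * sech (2 * d) t))) as [I HI]; auto.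
  { apply majorant_scal; auto. apply Mq; lra. }
  { intros t. eapply Rle_trans; [apply Bhh|]. apply Rmult_le_compat_l; auto.
    apply exp_abs_le_sech; lra. }
  replace (Cmult (RtoC (2 * PI)) (h 0)) with I; auto.
  assert (HPI := PI_RGT_0).
  destruct (majorant_sech d Hd) as [_ [_ [[L HL] _]]].
  assert (HL0 : 0 <= L) by (generalize (HL 0 0 (Rle_refl 0)); rewrite RInt_point; auto).
  assert (Ctl : ccont (fun v => Cminus (h v) (h 0))) by (apply ccont_minus; auto using ccont_const).
  (* In order: removal of the weight, oscillation of [h] near 0, and mass of the Poisson kernel away
     from 0. [K'] depends on [eta] but not on [eps]. *)
  assert (key : forall eta, 0 < eta -> exists K', 0 <= K' /\ forall eps, 0 < eps ->
     Cmod (Cminus I (Cmult (RtoC (2 * PI)) (h 0))) <= 2 * C / d * eps * L + 2 * PI * eta + 2 * PI * K' * eps).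
  { intros eta Heta.
    assert (Hloc : locally 0 (fun v => Cmod (Cminus (h v) (h 0)) < eta)).
    { apply (ccont_Cmod _ 0 Ctl (fun y => y < eta)). apply (open_lt eta).
      replace (Cminus (h 0) (h 0)) with (RtoC 0) by ring. now rewrite Cmod_0. }
    destruct Hloc as [r Hr].
    (* Chosen so that [K' * (r ^ 2 / (1 + r ^ 2))] is [2 * K], a bound for the oscillation of [h] at
       any distance. *)
    set (K' := 2 * K * (1 + r ^ 2) / r ^ 2).
    assert (Hr0 := cond_pos r).
    assert (HK' : 0 <= K').
    { unfold K'. apply Rmult_le_pos; [nra|]. left. apply Rinv_0_lt_compat. nra. }
    exists K'. split; auto. intros eps He.
    (* Against the kernel 2 eps / (eps^2 + v^2) the second term only contributes O(eps). *)
    assert (Hbd : forall v, Cmod (Cminus (h v) (h 0)) <= eta + K' * (v ^ 2 / (1 + v ^ 2))).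
    { intros v. assert (0 <= v ^ 2 / (1 + v ^ 2)).
      { apply Rmult_le_pos; [nra|]. left. apply Rinv_0_lt_compat. nra. }
      destruct (Rlt_dec (Rabs v) r) as [Hv|Hv].
      - assert (Cmod (Cminus (h v) (h 0)) < eta).
        { apply Hr. change (Rabs (v - 0) < r). now rewrite Rminus_0_r. }
        nra.
      - assert (Cmod (Cminus (h v) (h 0)) <= 2 * K).
        { unfold Cminus. eapply Rle_trans; [apply Cmod_triangle|]. rewrite Cmod_opp.
          assert (H1 := Bh v). assert (H2 := Bh 0).
          assert (H3 := sech_le_1 g v). assert (H4 := sech_le_1 g 0). nra. }
        assert (Hv2 : r ^ 2 <= v ^ 2).
        { rewrite <- (pow2_abs v). apply pow_incr. lra. }
        assert (r ^ 2 / (1 + r ^ 2) <= v ^ 2 / (1 + v ^ 2)).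
        { apply Rmult_le_reg_r with ((1 + r ^ 2) * (1 + v ^ 2)); [nra|].
          field_simplify; nra. }
        assert (K' * (r ^ 2 / (1 + r ^ 2)) = 2 * K).
        { unfold K'. field. split; nra. }
        nra. }
    set (Ie' := fun t => Cmult (RtoC (exp (- eps * Rabs t))) (hh t)).
    assert (Ce : ccont Ie').
    { unfold Ie'. apply ccont_mult; auto. apply ccont_RtoC.
      intros; apply continuous_exp_abs, continuous_id. }
    set (X := fun v => Cmult (h v) (RtoC (2 * eps / (eps ^ 2 + v ^ 2)))).
    assert (CX : ccont X).
    { unfold X. apply ccont_mult; auto. apply ccont_RtoC. intros; now apply continuous_cauchy_kernel. }
    destruct (is_CInt_ex Ie' (fun t => C * (2 * sech (2 * d) t))) as [J HJ]; auto.
    { apply majorant_scal; auto. apply Mq; lra. }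
    { intros t. unfold Ie'. rewrite Cmod_mult, Cmod_R, Rabs_right by (left; apply exp_pos).
      assert (exp (- eps * Rabs t) <= 1).
      { rewrite <- exp_0. apply exp_le_compat. generalize (Rabs_pos t). nra. }
      apply Rle_trans with (1 * Cmod (hh t)).
      - apply Rmult_le_compat_r; auto using Cmod_ge_0.
      - rewrite Rmult_1_l. eapply Rle_trans; [apply Bhh|]. apply Rmult_le_compat_l; auto.
        apply exp_abs_le_sech; lra. }
    assert (HX : is_CInt X J).
    { apply (is_CInt_fubini (fun t v => f eps v t) (fun t => 2 * sech eps t) (fun v => K * sech g v) Ie' X J); auto.
      - apply ccont2_swap, Cf.
      - intros t v. rewrite Rmult_comm. now apply Bf.
      - intros v. unfold X.
        apply is_CInt_ext with (fun t => Cmult (h v) (Cmult (Cexpc (Cmult (0, v) (RtoC t))) (RtoC (exp (- eps * Rabs t))))).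
        + intros t. unfold f. ring.
        + apply is_CInt_mult; [|now apply is_CInt_poisson].
          ccont_tac. intros; apply continuous_exp_abs, continuous_id. }
    (* Here 1 - exp (- eps |t|) <= eps |t| <= eps exp (d |t|) / d, and this growth uses up half of
       the decay rate [2 * d] of [hh]. *)
    assert (D1 : Cmod (Cminus I J) <= 2 * C / d * eps * L).
    { apply (is_CInt_bound (fun t => Cminus (hh t) (Ie' t)) (fun t => 2 * C / d * eps * sech d t)).
      - now apply ccont_minus.
      - intros x. apply continuous_scal_R, continuous_sech.
      - intros t. unfold Ie'.
        replace (Cminus _ _) with (Cmult (RtoC (1 - exp (- eps * Rabs t))) (hh t)) by (rewrite RtoC_minus; ring).
        rewrite Cmod_mult, Cmod_R.
        assert (0 <= Rabs t) by apply Rabs_pos.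
        assert (E1 : exp (- eps * Rabs t) <= 1) by (rewrite <- exp_0; apply exp_le_compat; nra).
        assert (E2 := exp_ineq1_le (- eps * Rabs t)).
        rewrite Rabs_right by lra.
        assert (E3 := exp_ineq1_le (d * Rabs t)).
        assert (E4 : Rabs t <= exp (d * Rabs t) / d).
        { apply Rmult_le_reg_r with d; auto. unfold Rdiv. rewrite Rmult_assoc, Rinv_l; lra. }
        apply Rle_trans with (eps * (exp (d * Rabs t) / d) * (C * exp (- (2 * d) * Rabs t))).
        + apply Rmult_le_compat; auto using Cmod_ge_0; [lra|]. nra.
        + replace (- (2 * d) * Rabs t) with (- (d * Rabs t) + - d * Rabs t) by ring.
          rewrite exp_plus, exp_Ropp.
          assert (P := exp_pos (d * Rabs t)).
          replace (eps * (exp (d * Rabs t) / d) * (C * (/ exp (d * Rabs t) * exp (- d * Rabs t))))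
            with (C / d * eps * exp (- d * Rabs t)) by (field; lra).
          replace (2 * C / d * eps * sech d t) with (C / d * eps * (2 * sech d t)) by (field; lra).
          apply Rmult_le_compat_l; [|apply exp_abs_le_sech; lra].
          apply Rmult_le_pos; [|lra]. apply Rmult_le_pos; auto. left. now apply Rinv_0_lt_compat.
      - intros a b Hab. rewrite RInt_scal_R; [|apply continuous_sech].
        apply Rmult_le_compat_l; auto. apply Rmult_le_pos; [|lra].
        apply Rmult_le_pos; [lra|]. left. now apply Rinv_0_lt_compat.
      - apply is_CInt_minus; auto. }
    assert (D2 : Cmod (Cminus J (Cmult (h 0) (RtoC (2 * PI)))) <= 2 * PI * eta + 2 * PI * K' * eps).
    (* Since v^2 <= eps^2 + v^2, the factor v^2 / (1 + v^2) turns the kernel with parameter [eps]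
       into at most [eps] times the kernel with parameter 1. *)
    { set (p := fun v => eta * (2 * eps / (eps ^ 2 + v ^ 2)) + K' * eps * (2 * 1 / (1 ^ 2 + v ^ 2))).
      assert (Cp1 : forall x, continuous (fun v => eta * (2 * eps / (eps ^ 2 + v ^ 2))) x).
      { intros x. apply continuous_scal_R. now apply continuous_cauchy_kernel. }
      assert (Cp2 : forall x, continuous (fun v => K' * eps * (2 * 1 / (1 ^ 2 + v ^ 2))) x).
      { intros x. apply continuous_scal_R. apply continuous_cauchy_kernel; lra. }
      assert (Cp : forall x, continuous p x).
      { intros x. unfold p. apply (continuous_plus (V:=R_NormedModule)); auto. }
      apply (is_CInt_bound (fun v => Cminus (X v) (Cmult (h 0) (RtoC (2 * eps / (eps ^ 2 + v ^ 2))))) p); auto.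
      - apply ccont_minus; auto. apply ccont_mult; [apply ccont_const|].
        apply ccont_RtoC. intros; now apply continuous_cauchy_kernel.
      - intros v. unfold X.
        replace (Cminus _ _) with (Cmult (RtoC (2 * eps / (eps ^ 2 + v ^ 2))) (Cminus (h v) (h 0))) by ring.
        rewrite Cmod_mult, Cmod_R.
        assert (Pk : 0 < 2 * eps / (eps ^ 2 + v ^ 2)) by (apply Rdiv_lt_0_compat; nra).
        rewrite Rabs_right by lra.
        apply Rle_trans with (2 * eps / (eps ^ 2 + v ^ 2) * (eta + K' * (v ^ 2 / (1 + v ^ 2)))).
        { apply Rmult_le_compat_l; auto. lra. }
        unfold p.
        replace (2 * eps / (eps ^ 2 + v ^ 2) * (eta + K' * (v ^ 2 / (1 + v ^ 2)))) with
          (eta * (2 * eps / (eps ^ 2 + v ^ 2)) + K' * eps * (2 * 1 / (1 ^ 2 + v ^ 2)) * (v ^ 2 / (eps ^ 2 + v ^ 2)))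
          by (field; split; nra).
        apply Rplus_le_compat_l. rewrite <- (Rmult_1_r (K' * eps * _)) at 2.
        apply Rmult_le_compat_l.
        + apply Rmult_le_pos; [nra|]. left. apply Rdiv_lt_0_compat; nra.
        + apply Rmult_le_reg_r with (eps ^ 2 + v ^ 2); [nra|].
          unfold Rdiv. rewrite Rmult_assoc, Rinv_l; nra.
      - intros a b Hab. unfold p.
        rewrite (RInt_plus (V:=R_CompleteNormedModule) (fun v => eta * (2 * eps / (eps ^ 2 + v ^ 2))));
          try (apply ex_RInt_cont; assumption).
        rewrite !RInt_scal_R; try (intros; apply continuous_cauchy_kernel; lra).
        rewrite !RInt_cauchy_kernel by lra. unfold plus; simpl.
        generalize (atan_bound (b / eps)) (atan_bound (a / eps)) (atan_bound (b / 1)) (atan_bound (a / 1)).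
        intros A1 A2 A3 A4.
        assert (2 * atan (b / eps) - 2 * atan (a / eps) <= 2 * PI) by lra.
        assert (2 * atan (b / 1) - 2 * atan (a / 1) <= 2 * PI) by lra.
        assert (0 <= K' * eps) by nra. nra.
      - apply is_CInt_minus; auto.
        + apply ccont_mult; [apply ccont_const|].
          apply ccont_RtoC. intros; now apply continuous_cauchy_kernel.
        + apply is_CInt_mult; [|now apply is_CInt_cauchy_kernel].
          apply ccont_RtoC. intros; now apply continuous_cauchy_kernel. }
    rewrite (Cmult_comm (RtoC (2 * PI))).
    eapply Rle_trans; [apply (Cmod_triangle_minus _ J)|]. lra. }
  apply Ceq_of_Cmod_le. intros e He.
  (* This choice makes the middle term [e / 2]; the other two sum to [q - 1] times the weight
     parameter, which is then taken to be [e / (2 * q)]. *)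
  destruct (key (e / (4 * PI))) as [K' [HK' B]]; [apply Rdiv_lt_0_compat; lra|].
  set (q := 2 * C / d * L + 2 * PI * K' + 1).
  assert (Hq : 0 < q).
  { unfold q. assert (0 <= 2 * C / d * L).
    { apply Rmult_le_pos; auto. apply Rmult_le_pos; [lra|]. left. now apply Rinv_0_lt_compat. }
    nra. }
  assert (Hs : 0 < e / (2 * q)) by (apply Rdiv_lt_0_compat; lra).
  specialize (B (e / (2 * q)) Hs).
  eapply Rle_trans; [apply B|].
  replace (2 * PI * (e / (4 * PI))) with (e / 2) by (field; lra).
  replace (2 * C / d * (e / (2 * q)) * L + e / 2 + 2 * PI * K' * (e / (2 * q)))
    with ((q - 1) * (e / (2 * q)) + e / 2) by (unfold q; ring).
  apply Rle_trans with (q * (e / (2 * q)) + e / 2); [lra|]. right. field. lra.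
Qed.

(** * The Mellin-Barnes formula *)

(** With the factor exp (xi z) removed from the kernel, the constant depends on [z] and [g] but not
    on the imaginary part of [xi]; bounds uniform along the vertical line follow. *)
Lemma rotated_bound (z : C) g : 0 < g -> Rabs (snd z) < PI / 2 ->
  exists K, 0 < K /\ forall v (xi : C), fst xi = g ->
    Cmod (Cexpc (Cplus (Copp (Cexpc (Cplus (RtoC v) z))) (Cmult xi (RtoC v)))) <= K * sech g v.
Proof.
  intros Hg Hz.
  assert (Hc : 0 < cos (snd z)) by (apply Rabs_def2 in Hz; apply cos_gt_0; lra).
  destruct (double_exp_le_sech (exp (fst z) * cos (snd z)) g) as [K [HK B]]; auto.
  { apply Rmult_lt_0_compat; auto. apply exp_pos. }
  exists K. split; auto. intros v xi Hxi. rewrite Cmod_Cexpc.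
  eapply Rle_trans; [|apply B]. right. f_equal. simpl. rewrite Hxi, Rplus_0_l, exp_plus. ring.
Qed.

(** Gamma does not depend on the angle of rotation. Rotating by [s] beyond [z] gives a bound uniform
    in [t], and undoing the extra rotation leaves the factor exp (- s t); the sign of [s] is then
    taken to be that of [t]. *)
Lemma gamma_decay (z : C) g : 0 < g -> Rabs (snd z) < PI / 2 ->
  exists C d, 0 <= C /\ 0 < d /\ forall t,
    Cmod (Cmult (Cexpc (Copp (Cmult (g, t) z))) (CGamma (g, t))) <= C * exp (- (2 * d) * Rabs t).
Proof.
  (* A quarter of the angle left below pi/2, so that an extra rotation by [2 * d] either way is
     still admissible. *)
  intros Hg Hz. set (d := (PI / 2 - Rabs (snd z)) / 4).
  assert (Hd : 0 < d) by (unfold d; lra).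
  destruct (majorant_sech g Hg) as [Cs [_ [[L HL] _]]].
  assert (HL0 : 0 <= L) by (generalize (HL 0 0 (Rle_refl 0)); rewrite RInt_point; auto).
  assert (B : forall s, Rabs s <= 2 * d -> exists C, 0 <= C /\ forall t,
     Cmod (Cmult (Cexpc (Copp (Cmult (g, t) z))) (CGamma (g, t))) <= C * exp (- (s * t))).
  { intros s Hs. set (z' := Cplus z (0, s)).
    assert (Hz' : Rabs (snd z') < PI / 2).
    { unfold z'; simpl. eapply Rle_lt_trans; [apply Rabs_triang|]. unfold d in *. lra. }
    destruct (rotated_bound z' g Hg Hz') as [K [HK B]].
    exists (K * L). split; [nra|]. intros t.
    assert (I := is_CInt_rotate (g, t) z' _ Hg Hz' (is_CInt_CGamma (g, t) Hg)).
    assert (B' : Cmod (Cmult (Cexpc (Copp (Cmult (g, t) z'))) (CGamma (g, t))) <= K * L).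
    { refine (is_CInt_bound _ (fun v => K * sech g v) _ _ _ _ _ _ I).
      - ccont_tac.
      - intros; now apply continuous_scal_R.
      - intros v. now apply B.
      - intros a b Hab. rewrite RInt_scal_R; auto. apply Rmult_le_compat_l; [lra|auto]. }
    replace (Cexpc (Copp (Cmult (g, t) z))) with (Cmult (Cexpc (Cmult (g, t) (0, s))) (Cexpc (Copp (Cmult (g, t) z')))).
    2:{ rewrite <- Cexpc_plus. f_equal. unfold z'. ring. }
    rewrite <- Cmult_assoc, Cmod_mult, Cmod_Cexpc.
    replace (fst (Cmult (g, t) (0, s))) with (- (s * t)) by (simpl; ring).
    rewrite Rmult_comm. apply Rmult_le_compat_r; auto. left; apply exp_pos. }
  destruct (B (2 * d)) as [C1 [HC1 B1]]; [rewrite Rabs_right; lra|].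
  destruct (B (- (2 * d))) as [C2 [HC2 B2]]; [rewrite Rabs_left; lra|].
  exists (C1 + C2), d. split; [lra|]. split; auto. intros t.
  assert (Pe := exp_pos (- (2 * d) * Rabs t)).
  destruct (Rle_dec 0 t).
  - specialize (B1 t). rewrite Rabs_right in * by lra.
    replace (- (2 * d) * t) with (- (2 * d * t)) in * by ring. nra.
  - specialize (B2 t). rewrite Rabs_left in * by lra.
    replace (- (2 * d) * - t) with (- (- (2 * d) * t)) in * by ring. nra.
Qed.

(* Mellin inversion of [exp (- w)] at [w = exp z]. *)
Lemma mellin_exp (z : C) g : 0 < g -> Rabs (snd z) < PI / 2 ->
  ccont (fun t => Cmult (Cexpc (Copp (Cmult (g, t) z))) (CGamma (g, t))) /\
  is_CInt (fun t => Cmult (Cexpc (Copp (Cmult (g, t) z))) (CGamma (g, t)))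
      (Cmult (RtoC (2 * PI)) (Cexpc (Copp (Cexpc z)))).
Proof.
  intros Hg Hz.
  destruct (gamma_decay z g Hg Hz) as [C [d [HC [Hd B]]]].
  destruct (rotated_bound z g Hg Hz) as [K [HK Bh]].
  set (h := fun v => Cexpc (Cplus (Copp (Cexpc (Cplus (RtoC v) z))) (Cmult (RtoC g) (RtoC v)))).
  replace (Cexpc (Copp (Cexpc z))) with (h 0).
  2:{ unfold h. f_equal. rewrite Cmult_0_r, Cplus_0_r, Cplus_0_l. reflexivity. }
  apply (fourier_inversion h _ g K C d); auto; try lra.
  - unfold h. ccont_tac.
  - intros v. now apply Bh.
  - intros t. eapply is_CInt_ext; [|apply (is_CInt_rotate (g, t) z _ Hg Hz (is_CInt_CGamma (g, t) Hg))].
    intros v. unfold h. rewrite <- Cexpc_plus. f_equal.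
    unfold Cplus, Cmult, RtoC; simpl. f_equal; ring.
Qed.

(** With r = exp v, B = exp b and k s = exp S this is exp (- B r - k s r^beta) dr. *)
Definition laplace_integrand (beta : R) (S b : C) (v : R) : C :=
  Cexpc (Cplus (Cplus (Copp (Cexpc (Cplus (RtoC v) b))) (RtoC v))
               (Copp (Cexpc (Cplus S (Cmult (RtoC beta) (RtoC v)))))).

Lemma ccont_laplace_integrand beta S b : ccont (laplace_integrand beta S b).
Proof. unfold laplace_integrand. ccont_tac. Qed.

(** The Jacobian exp v and the factor exp (- xi beta v) from Mellin inversion combine to the
    exponent eta = 1 - beta xi, so the integral over [v] is a rotated Gamma integral at eta. The
    condition [beta * g < 1] puts eta in the right half-plane. *)
Lemma mellin_barnes beta g S b I : 0 < beta -> 0 < g -> beta * g < 1 ->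
  Rabs (snd S) < PI / 2 -> Rabs (snd b) < PI / 2 ->
  is_CInt (laplace_integrand beta S b) I ->
  let F := fun t => let xi := (g, t) in let eta := Cminus 1%C (Cmult (RtoC beta) xi) in
    Cmult (Cmult (CGamma xi) (CGamma eta)) (Cexpc (Copp (Cplus (Cmult xi S) (Cmult eta b)))) in
  ccont F /\ is_CInt F (Cmult (RtoC (2 * PI)) I).
Proof.
  intros Hbeta Hg Hbg HS Hb HI F.
  destruct (gamma_decay S g Hg HS) as [C [d [HC [Hd BC]]]].
  assert (Hg' : 0 < 1 - beta * g) by lra.
  destruct (rotated_bound b (1 - beta * g) Hg' Hb) as [K [HK BK]].
  set (eta := fun t => Cminus 1%C (Cmult (RtoC beta) (g, t))).
  assert (Heta : forall t, fst (eta t) = 1 - beta * g) by (intros t; unfold eta; simpl; ring).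
  set (hS := fun t => Cmult (Cexpc (Copp (Cmult (g, t) S))) (CGamma (g, t))).
  assert (ChS : ccont hS) by apply (mellin_exp S g Hg HS).
  set (f := fun v t => Cmult (Cexpc (Cplus (Copp (Cexpc (Cplus (RtoC v) b))) (Cmult (eta t) (RtoC v)))) (hS t)).
  assert (Cf : ccont2 f).
  { unfold ccont2, f, eta. apply ccont_mult.
    - ccont_tac.
    - apply (ccont_comp hS (fun p : R_UniformSpace * R_UniformSpace => snd p)); auto.
      intros [x y]. apply continuous_snd. }
  assert (Bf : forall v t, Cmod (f v t) <= K * sech (1 - beta * g) v * (C * (2 * sech (2 * d) t))).
  { intros v t. unfold f. rewrite Cmod_mult. apply Rmult_le_compat; try apply Cmod_ge_0.
    - apply BK. apply Heta.
    - eapply Rle_trans; [apply BC|]. apply Rmult_le_compat_l; auto. apply exp_abs_le_sech; lra. }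
  assert (Mp : majorant (fun v => K * sech (1 - beta * g) v)) by (apply majorant_scal; [lra|now apply majorant_sech]).
  assert (Mq : majorant (fun t => C * (2 * sech (2 * d) t))).
  { apply majorant_scal; auto. apply majorant_scal; [lra|]. apply majorant_sech; lra. }
  assert (IF : forall t, is_CInt (fun v => f v t) (F t)).
  { intros t.
    replace (F t) with (Cmult (hS t) (Cmult (Cexpc (Copp (Cmult (eta t) b))) (CGamma (eta t)))).
    2:{ unfold F, hS. fold (eta t).
        replace (Copp (Cplus (Cmult (g, t) S) (Cmult (eta t) b))) with
          (Cplus (Copp (Cmult (g, t) S)) (Copp (Cmult (eta t) b))) by ring.
        rewrite Cexpc_plus. ring. }
    apply is_CInt_ext with (fun v => Cmult (hS t) (Cexpc (Cplus (Copp (Cexpc (Cplus (RtoC v) b))) (Cmult (eta t) (RtoC v))))).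
    - intros v. unfold f. ring.
    - assert (0 < fst (eta t)) by (rewrite Heta; lra).
      apply is_CInt_mult; [ccont_tac|]. apply is_CInt_rotate; auto. now apply is_CInt_CGamma. }
  set (X := fun v => Cmult (RtoC (2 * PI)) (laplace_integrand beta S b v)).
  assert (IX : forall v, is_CInt (fun t => f v t) (X v)).
  (* The imaginary part of [z] is that of [S] for every [v], so Mellin inversion applies along the
     whole line. *)
  { intros v. set (z := Cplus S (Cmult (RtoC beta) (RtoC v))).
    assert (Hz : Rabs (snd z) < PI / 2).
    { unfold z; simpl. replace (snd S + (beta * 0 + 0 * v)) with (snd S) by ring. auto. }
    destruct (mellin_exp z g Hg Hz) as [C1 I1].
    apply (is_CInt_mult (Cexpc (Cplus (Copp (Cexpc (Cplus (RtoC v) b))) (RtoC v)))) in I1; auto.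
    replace (X v) with (Cmult (Cexpc (Cplus (Copp (Cexpc (Cplus (RtoC v) b))) (RtoC v)))
       (Cmult (RtoC (2 * PI)) (Cexpc (Copp (Cexpc z))))).
    2:{ unfold X, laplace_integrand. fold z. rewrite (Cexpc_plus _ (Copp (Cexpc z))). ring. }
    revert I1. apply is_CInt_ext. intros t. unfold f, hS.
    rewrite !Cmult_assoc, <- !Cexpc_plus. f_equal. f_equal. unfold eta, z. ring. }
  split.
  - apply (ccont_is_CInt (fun t v => f v t) (fun t => C * (2 * sech (2 * d) t)) (fun v => K * sech (1 - beta * g) v)); auto.
    + now apply ccont2_swap.
    + intros t v. rewrite Rmult_comm. apply Bf.
  - apply (is_CInt_fubini f _ _ X F _ Cf Mp Mq Bf IX IF).
    apply is_CInt_mult; auto. apply ccont_laplace_integrand.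
Qed.

(** * The maximum of two independent distances *)

(** Separate functions serve the two ends because the integrand over [y] changes form where [y]
    passes [x]; [c] is that point. *)
Lemma is_RInt_gen_antideriv (f Wa Wb : R -> R) (c wa wb : R) : 0 < c ->
  (forall a b, 0 < a < c -> c < b -> is_RInt f a b (Wb b - Wa a)) ->
  filterlim Wa (at_right 0) (locally wa) ->
  filterlim Wb (Rbar_locally p_infty) (locally wb) ->
  is_RInt_gen f (at_right 0) (Rbar_locally p_infty) (wb - wa).
Proof.
  intros Hc Hf Ha Hb. apply filterlimi_locally. intros eps.
  assert (He : 0 < eps / 2) by (generalize (cond_pos eps); lra).
  assert (La := Ha _ (locally_ball wa (mkposreal _ He))).
  assert (Lb := Hb _ (locally_ball wb (mkposreal _ He))).
  unfold filtermap in La, Lb.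
  assert (La' : at_right 0 (fun a => 0 < a < c)).
  { exists (mkposreal _ Hc). simpl. intros y Hy Hy0. change (Rabs (y - 0) < c) in Hy.
    rewrite Rminus_0_r, Rabs_right in Hy; lra. }
  assert (Lb' : Rbar_locally p_infty (fun b => c < b)) by (exists c; auto).
  eapply Filter_prod; [exact (filter_and _ _ La La') | exact (filter_and _ _ Lb Lb') |].
  intros a b [Ha1 Ha2] [Hb1 Hb2]. exists (Wb b - Wa a). split; [now apply Hf|].
  change (Rabs (Wa a - wa) < eps / 2) in Ha1. change (Rabs (Wb b - wb) < eps / 2) in Hb1.
  change (Rabs (Wb b - Wa a - (wb - wa)) < eps).
  replace (Wb b - Wa a - (wb - wa)) with ((Wb b - wb) - (Wa a - wa)) by ring.
  apply Rabs_def2 in Ha1. apply Rabs_def2 in Hb1. apply Rabs_def1; lra.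
Qed.

Lemma filterlim_at_right_continuous (f : R -> R) : continuous f 0 ->
  filterlim f (at_right 0) (locally (f 0)).
Proof.
  intros H P HP. generalize (H P HP). unfold filtermap, at_right, within.
  apply filter_imp. auto.
Qed.

Lemma is_lim_seq_Rabs_le (u : nat -> R) (l c e : R) N : is_lim_seq u l ->
  (forall n, (N <= n)%nat -> Rabs (u n - c) <= e) -> Rabs (l - c) <= e.
Proof.
  intros Hu H. apply le_epsilon. intros eps He.
  apply is_lim_seq_spec in Hu. destruct (Hu (mkposreal _ He)) as [M HM]. simpl in HM.
  specialize (HM (N + M)%nat ltac:(lia)). specialize (H (N + M)%nat ltac:(lia)).
  apply Rabs_def2 in HM. apply Rabs_le_between in H. apply Rabs_le. lra.
Qed.

Section MaxOfTwo.
Variables (lam : R) (g : R -> R).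
Hypothesis Hlam : 0 < lam.
Hypothesis Cg : forall x, continuous g x.
Hypothesis Bg : forall x, Rabs (g x) <= 1.

(** [F] is the distribution function of one distance, so [2 * F x * fd lam x] is the density of the
    maximum; [Q] accumulates the expectation of [g] over one distance. *)
Let m := ccst * lam * PI.
Let F (x : R) := 1 - exp (- (m * x ^ 2)).
Let u (x : R) := fd lam x * g x.
Let Q (x : R) := RInt u 0 x.

Local Lemma m_pos : 0 < m.
Proof.
  unfold m, ccst. generalize PI_RGT_0. intros.
  apply Rmult_lt_0_compat; auto. lra.
Qed.

Local Lemma F_deriv x : is_derive F x (fd lam x).
Proof. unfold F, fd. fold m. auto_derive; auto. simpl. unfold m. ring. Qed.

Local Lemma fd_cont x : continuous (fd lam) x.
Proof. unfold fd. apply continuous_ex_derive. auto_derive. auto. Qed.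

Local Lemma F_cont x : continuous F x.
Proof. apply continuous_ex_derive. exists (fd lam x). apply F_deriv. Qed.

Local Lemma u_cont x : continuous u x.
Proof. apply (continuous_mult (K:=R_AbsRing)); [apply fd_cont | apply Cg]. Qed.

Local Lemma Q_deriv x : is_derive Q x (u x).
Proof.
  apply (is_derive_RInt u Q 0).
  - apply filter_forall. intros y. apply (RInt_correct (V:=R_CompleteNormedModule)).
    apply ex_RInt_cont, u_cont.
  - apply u_cont.
Qed.

Local Lemma Q_cont x : continuous Q x.
Proof. apply continuous_ex_derive. exists (u x). apply Q_deriv. Qed.

Local Lemma Q_diff a b : RInt u a b = Q b - Q a.
Proof. apply RInt_FTC; [apply Q_deriv | apply u_cont]. Qed.

Local Lemma fd_nonneg x : 0 <= x -> 0 <= fd lam x.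
Proof.
  intros Hx. unfold fd. apply Rmult_le_pos; [|left; apply exp_pos].
  assert (H := m_pos). unfold m in H. nra.
Qed.

(** As [g] is bounded by 1, the increment of [Q] is at most that of [F], hence at most the tail
    probability beyond [a]. *)
Local Lemma Q_cauchy a b : 0 <= a <= b -> Rabs (Q b - Q a) <= exp (- (m * a ^ 2)).
Proof.
  intros Hab. rewrite <- Q_diff.
  apply Rle_trans with (RInt (fd lam) a b).
  - apply (norm_RInt_le (V:=R_NormedModule) u (fd lam) a b); [lra| | |].
    + intros x Hx. unfold norm; simpl; unfold abs; simpl. unfold u. rewrite Rabs_mult.
      assert (H := fd_nonneg x ltac:(lra)). rewrite (Rabs_right (fd lam x)) by lra.
      generalize (Bg x) (Rabs_pos (g x)). nra.
    + apply (RInt_correct (V:=R_CompleteNormedModule)). apply ex_RInt_cont, u_cont.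
    + apply (RInt_correct (V:=R_CompleteNormedModule)). apply ex_RInt_cont, fd_cont.
  - rewrite (RInt_FTC F); [|apply F_deriv|apply fd_cont]. unfold F.
    generalize (exp_pos (- (m * b ^ 2))). lra.
Qed.

Local Lemma exp_sq_small eps : 0 < eps -> exists M, 0 < M /\ forall x, M <= x -> exp (- (m * x ^ 2)) <= eps.
Proof.
  intros He. destruct (exp_neg_small m eps m_pos He) as [M [HM A]].
  exists (M + 1). split; [lra|]. intros x Hx. eapply Rle_trans; [|apply A].
  apply exp_le_compat. apply Ropp_le_contravar.
  apply Rmult_le_compat_l; [left; apply m_pos | nra].
Qed.

Local Lemma Q_limit : exists Qi, forall x, 0 <= x -> Rabs (Qi - Q x) <= exp (- (m * x ^ 2)).
Proof.
  assert (E : ex_finite_lim_seq (fun n => Q (INR n))).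
  { apply ex_lim_seq_cauchy_corr. intros eps.
    destruct (exp_sq_small (eps / 2)) as [M [HM A]]; [generalize (cond_pos eps); lra|].
    destruct (nfloor_ex M) as [N HN]; [lra|]. exists (S N).
    assert (B : forall n k, (S N <= n)%nat -> (n <= k)%nat -> Rabs (Q (INR k) - Q (INR n)) < eps).
    { intros n k Hn Hk.
      assert (INR (S N) <= INR n) by now apply le_INR. rewrite S_INR in H.
      assert (INR n <= INR k) by now apply le_INR.
      eapply Rle_lt_trans; [apply Q_cauchy; lra|].
      eapply Rle_lt_trans; [apply A; lra|]. generalize (cond_pos eps); lra. }
    intros n k Hn Hk. destruct (Nat.le_ge_cases n k).
    - rewrite Rabs_minus_sym. auto.
    - auto. }
  destruct E as [Qi E]. exists Qi. intros x Hx.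
  destruct (nfloor_ex x Hx) as [N HN].
  apply (is_lim_seq_Rabs_le _ _ _ _ (S N) E). intros n Hn.
  assert (INR (S N) <= INR n) by now apply le_INR. rewrite S_INR in H.
  apply Q_cauchy. lra.
Qed.

(** The inner integral yields [F x * u x] from [y] below [x] and [fd lam x * (Qi - Q x)] from [y]
    above it. Integration by parts shows that the two have the same integral over [x], which
    produces the factor 2 and avoids exchanging the order of integration. *)
Lemma max_of_two_integral V :
  is_RInt_gen (fun x => 2 * F x * (fd lam x * g x)) (at_right 0) (Rbar_locally p_infty) V ->
  RInt_gen (fun x => RInt_gen (fun y => fd lam x * fd lam y * g (Rmax x y))
     (at_right 0) (Rbar_locally p_infty)) (at_right 0) (Rbar_locally p_infty) = V.
Proof.
  intros HV. destruct Q_limit as [Qi HQ].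
  assert (LQ : filterlim Q (Rbar_locally p_infty) (locally Qi)).
  { apply filterlim_locally. intros eps.
    destruct (exp_sq_small (eps / 2)) as [M [HM A]]; [generalize (cond_pos eps); lra|].
    exists M. intros x Hx. change (Rabs (Q x - Qi) < eps).
    rewrite Rabs_minus_sym. eapply Rle_lt_trans; [apply HQ; lra|].
    eapply Rle_lt_trans; [apply A; lra|]. generalize (cond_pos eps); lra. }
  assert (F0 : F 0 = 0) by (unfold F; replace (- (m * 0 ^ 2)) with 0 by ring; rewrite exp_0; ring).
  assert (Inner : forall x, 0 < x ->
    RInt_gen (fun y => fd lam x * fd lam y * g (Rmax x y)) (at_right 0) (Rbar_locally p_infty)
    = fd lam x * (F x * g x + Qi - Q x)).
  { intros x Hx. apply (is_RInt_gen_unique (V:=R_CompleteNormedModule)).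
    replace (fd lam x * (F x * g x + Qi - Q x)) with (fd lam x * (F x * g x + Qi - Q x) - fd lam x * (F 0 * g x))
      by (rewrite F0; ring).
    apply (is_RInt_gen_antideriv _ (fun a => fd lam x * (F a * g x)) (fun b => fd lam x * (F x * g x + Q b - Q x)) x); auto.
    - intros a b Ha Hb.
      replace (_ - _) with ((fd lam x * (F x * g x) - fd lam x * (F a * g x)) + (fd lam x * Q b - fd lam x * Q x)) by ring.
      apply (is_RInt_Chasles (V:=R_NormedModule) _ a x b).
      + apply (is_RInt_ext (V:=R_NormedModule) (fun y => fd lam x * (fd lam y * g x))).
        * intros y Hy. rewrite Rmin_left, Rmax_right in Hy by lra. rewrite Rmax_left by lra.
          match goal with |- @eq _ ?a ?b => change (@eq R a b) end; ring.
        * apply (is_RInt_derive (V:=R_CompleteNormedModule) (fun y => fd lam x * (F y * g x))).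
          -- intros y _. apply is_derive_scal.
             apply (is_derive_scal_l (K:=R_AbsRing) (V:=R_NormedModule) F). apply F_deriv.
          -- intros y _. apply continuous_scal_R. apply (continuous_mult (K:=R_AbsRing)); [apply fd_cont|apply continuous_const].
      + apply (is_RInt_ext (V:=R_NormedModule) (fun y => fd lam x * u y)).
        * intros y Hy. rewrite Rmin_left, Rmax_right in Hy by lra. rewrite Rmax_right by lra. unfold u.
          match goal with |- @eq _ ?a ?b => change (@eq R a b) end; ring.
        * apply (is_RInt_derive (V:=R_CompleteNormedModule) (fun y => fd lam x * Q y)).
          -- intros y _. apply is_derive_scal. apply Q_deriv.
          -- intros y _. apply continuous_scal_R, u_cont.
    - apply (filterlim_at_right_continuous (fun a => fd lam x * (F a * g x))).
      apply continuous_scal_R. apply (continuous_mult (K:=R_AbsRing)); [apply F_cont|apply continuous_const].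
    - apply (filterlim_comp _ _ _ Q (fun q => fd lam x * (F x * g x + q - Q x)) _ (locally Qi)); auto.
      apply (continuous_ex_derive (fun q => fd lam x * (F x * g x + q - Q x))). auto_derive. auto. }
  (* The integrand is the derivative of [F x * (Qi - Q x)], which vanishes at 0 through [F] and at
     infinity through [Qi - Q x]. *)
  assert (P : is_RInt_gen (fun x => fd lam x * (Qi - Q x) - F x * u x) (at_right 0) (Rbar_locally p_infty) (0 - 0)).
  { apply (is_RInt_gen_antideriv _ (fun x => F x * (Qi - Q x)) (fun x => F x * (Qi - Q x)) 1); [lra| | |].
    - intros a b Ha Hb.
      apply (is_RInt_derive (V:=R_CompleteNormedModule) (fun x => F x * (Qi - Q x))).
      + intros x _.
        replace (fd lam x * (Qi - Q x) - F x * u x) with (fd lam x * (Qi - Q x) + F x * (0 - u x)) by ring.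
        apply (is_derive_mult F (fun x => Qi - Q x)).
        * apply F_deriv.
        * apply (is_derive_minus (K:=R_AbsRing) (V:=R_NormedModule)).
          -- apply (is_derive_const (K:=R_AbsRing) (V:=R_NormedModule)).
          -- apply Q_deriv.
        * intros; apply Rmult_comm.
      + intros x _. apply (continuous_minus (V:=R_NormedModule)); apply (continuous_mult (K:=R_AbsRing)).
        * apply fd_cont.
        * apply (continuous_minus (V:=R_NormedModule)); [apply continuous_const|apply Q_cont].
        * apply F_cont.
        * apply u_cont.
    - replace 0 with (F 0 * (Qi - Q 0)) at 2 by (rewrite F0; ring).
      apply (filterlim_at_right_continuous (fun x => F x * (Qi - Q x))).
      apply (continuous_mult (K:=R_AbsRing)); [apply F_cont|].
      apply (continuous_minus (V:=R_NormedModule)); [apply continuous_const|apply Q_cont].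
    - apply filterlim_locally. intros eps.
      destruct (exp_sq_small (eps / 2)) as [M [HM A]]; [generalize (cond_pos eps); lra|].
      exists M. intros x Hx. change (Rabs (F x * (Qi - Q x) - 0) < eps).
      rewrite Rminus_0_r, Rabs_mult.
      assert (H1 := HQ x ltac:(lra)). assert (H2 := A x ltac:(lra)).
      assert (Rabs (F x) <= 1).
      { unfold F. assert (exp (- (m * x ^ 2)) <= 1).
        { rewrite <- exp_0. apply exp_le_compat. assert (H := m_pos). nra. }
        generalize (exp_pos (- (m * x ^ 2))). intros. apply Rabs_le. lra. }
      assert (H3 := Rabs_pos (F x)). assert (H4 := Rabs_pos (Qi - Q x)).
      generalize (cond_pos eps). nra. }
  apply (is_RInt_gen_unique (V:=R_CompleteNormedModule)).
  assert (S := is_RInt_gen_plus (V:=R_NormedModule) _ _ _ _ HV P).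
  replace V with (plus V (0 - 0)) by (unfold plus; simpl; ring).
  revert S. apply (is_RInt_gen_ext (V:=R_NormedModule)).
  apply (Filter_prod _ _ _ (fun a => 0 < a) (fun b => 0 < b)).
  - exists (mkposreal 1 Rlt_0_1). intros; auto.
  - exists 0; auto.
  - intros a b Ha Hb x Hx. simpl in Hx.
    assert (0 < Rmin a b) by (apply Rmin_glb_lt; lra).
    rewrite Inner by lra. unfold plus; simpl. unfold u.
    match goal with |- @eq _ ?a ?b => change (@eq R a b) end; ring.
Qed.
End MaxOfTwo.

Lemma Emax_eq lam k (G : R -> C) V : 0 < lam -> 0 < k -> ccont G -> (forall x, Cmod (G x) <= 1) ->
  is_CInt (fun v => let x := exp (k * v) in
     Cmult (RtoC (k * x * (2 * (1 - exp (- (ccst * lam * PI * x ^ 2))) * fd lam x))) (G x)) V ->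
  Emax lam G = V.
Proof.
  intros Hlam Hk [C1 C2] BG HV. unfold Emax, CInt0inf at 1, CInt_gen.
  rewrite (surjective_pairing V). f_equal.
  - transitivity (RInt_gen (fun x => RInt_gen (fun y => fd lam x * fd lam y * fst (G (Rmax x y)))
       (at_right 0) (Rbar_locally p_infty)) (at_right 0) (Rbar_locally p_infty)).
    { f_equal. apply functional_extensionality. intros x. simpl. f_equal.
      apply functional_extensionality. intros y. ring. }
    apply (max_of_two_integral lam (fun x => fst (G x)) Hlam C1).
    { intros x. eapply Rle_trans; [apply fst_le_Cmod|apply BG]. }
    apply (is_RInt_gen_halfline _ k); auto.
    { intros x _. apply (continuous_mult (K:=R_AbsRing)).
      - apply continuous_scal_R. now apply F_cont.
      - apply (continuous_mult (K:=R_AbsRing)); [now apply fd_cont|apply C1]. }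
    intros eps He. destruct (is_CInt_fst _ _ eps HV He) as [M [HM A]]. exists M. split; auto.
    intros a b Ha Hb. specialize (A a b Ha Hb).
    match type of A with Rabs (RInt ?f _ _ - _) < _ => rewrite (RInt_ext _ f); auto end.
    intros x _. simpl. ring.
  - transitivity (RInt_gen (fun x => RInt_gen (fun y => fd lam x * fd lam y * snd (G (Rmax x y)))
       (at_right 0) (Rbar_locally p_infty)) (at_right 0) (Rbar_locally p_infty)).
    { f_equal. apply functional_extensionality. intros x. simpl. f_equal.
      apply functional_extensionality. intros y. ring. }
    apply (max_of_two_integral lam (fun x => snd (G x)) Hlam C2).
    { intros x. eapply Rle_trans; [apply snd_le_Cmod|apply BG]. }
    apply (is_RInt_gen_halfline _ k); auto.
    { intros x _. apply (continuous_mult (K:=R_AbsRing)).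
      - apply continuous_scal_R. now apply F_cont.
      - apply (continuous_mult (K:=R_AbsRing)); [now apply fd_cont|apply C2]. }
    intros eps He. destruct (is_CInt_snd _ _ eps HV He) as [M [HM A]]. exists M. split; auto.
    intros a b Ha Hb. specialize (A a b Ha Hb).
    match type of A with Rabs (RInt ?f _ _ - _) < _ => rewrite (RInt_ext _ f); auto end.
    intros x _. simpl. ring.
Qed.

(** * Principal logarithms and Laplace integrals *)

Lemma atan_le x y : x <= y -> atan x <= atan y.
Proof. intros [H|H]; [left; now apply atan_increasing | right; now rewrite H]. Qed.

Lemma Clogc_snd (z : C) : 0 < fst z -> snd (Clogc z) = atan (snd z / fst z).
Proof. intros H. simpl. unfold Argc. destruct (Rlt_dec 0 (fst z)); [auto|lra]. Qed.

Lemma Clogc_snd_bound (z : C) : 0 < fst z -> Rabs (snd (Clogc z)) < PI / 2.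
Proof.
  intros H. rewrite Clogc_snd; auto. generalize (atan_bound (snd z / fst z)).
  intros. apply Rabs_def1; lra.
Qed.

Lemma Cexpc_Clogc (z : C) : 0 < fst z -> Cexpc (Clogc z) = z.
Proof.
  intros H. assert (S := Clogc_snd z H). destruct z as [a b]. simpl fst in H.
  unfold Cexpc. rewrite S. unfold Clogc. simpl fst. simpl snd.
  rewrite exp_ln by (apply Cmod_gt_0; intros E; apply (f_equal fst) in E; simpl in E; lra).
  rewrite cos_atan, sin_atan.
  assert (E : Cmod (a, b) = a * sqrt (1 + (b / a)²)).
  { transitivity (sqrt (a * a) * sqrt (1 + (b / a)²)); [|rewrite sqrt_square by lra; reflexivity].
    rewrite <- sqrt_mult_alt by nra. unfold Cmod; simpl. f_equal. unfold Rsqr. field. lra. }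
  rewrite E. assert (0 < sqrt (1 + (b / a)²)).
  { apply sqrt_lt_R0. generalize (Rle_0_sqr (b / a)). lra. }
  f_equal; field; lra.
Qed.

Lemma Cexpc_fst_pos (w : C) : Rabs (snd w) < PI / 2 -> 0 < fst (Cexpc w).
Proof.
  intros H. simpl. apply Rmult_lt_0_compat; [apply exp_pos|].
  apply Rabs_def2 in H. apply cos_gt_0; lra.
Qed.

Lemma Clogc_Cexpc (w : C) : Rabs (snd w) < PI / 2 -> Clogc (Cexpc w) = w.
Proof.
  intros H. assert (P := Cexpc_fst_pos w H). assert (S := Clogc_snd _ P).
  rewrite (surjective_pairing (Clogc _)), S. unfold Clogc; simpl fst at 1.
  rewrite Cmod_Cexpc, ln_exp, (surjective_pairing w). simpl. f_equal.
  apply Rabs_def2 in H. assert (0 < cos (snd w)) by (apply cos_gt_0; lra).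
  replace (exp (fst w) * sin (snd w) / (exp (fst w) * cos (snd w))) with (tan (snd w)).
  - apply atan_tan. lra.
  - unfold tan. field. split; [lra|]. generalize (exp_pos (fst w)); lra.
Qed.

Lemma Cpowc_eq (z w : C) : 0 < fst z -> Cpowc z w = Cexpc (Cmult w (Clogc z)).
Proof. intros H. unfold Cpowc. destruct (Req_EM_T (fst z) 0); [lra|auto]. Qed.

Lemma Cnonzero_fst (z : C) : 0 < fst z -> z <> 0%C.
Proof. intros H E. apply (f_equal fst) in E. simpl in E. lra. Qed.

(* Adding a positive real to a number of argument p moves the argument towards 0. *)
Lemma angle_bound (beta th c r : R) : 0 < beta -> 0 < c -> 0 < r -> Rabs (th / beta) < PI / 2 -> Rabs th < PI / 2 ->
  Rabs (th - beta * atan (r * sin (th / beta) / (c + r * cos (th / beta)))) < PI / 2.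
Proof.
  intros Hb Hc Hr Hp Ht. set (p := th / beta) in *.
  assert (E : th = beta * p) by (unfold p; field; lra).
  apply Rabs_def2 in Hp. assert (Hcos : 0 < cos p) by (apply cos_gt_0; lra).
  set (y := r * sin p / (c + r * cos p)).
  assert (D : 0 < c + r * cos p) by nra.
  assert (Y : tan p - y = sin p * (c / (cos p * (c + r * cos p)))).
  { unfold y, tan. field. split; lra. }
  assert (Y' : y = sin p * (r / (c + r * cos p))) by (unfold y; field; lra).
  assert (P1 : 0 < c / (cos p * (c + r * cos p))) by (apply Rdiv_lt_0_compat; auto; nra).
  assert (P2 : 0 < r / (c + r * cos p)) by (apply Rdiv_lt_0_compat; auto).
  assert (T : atan (tan p) = p) by (apply atan_tan; lra).
  assert (Z := atan_0). apply Rabs_def2 in Ht.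
  destruct (Rle_dec 0 p).
  - assert (0 <= sin p) by (apply sin_ge_0; generalize PI_RGT_0; lra).
    assert (A1 := atan_le y (tan p) ltac:(nra)). assert (A2 := atan_le 0 y ltac:(nra)).
    apply Rabs_def1; nra.
  - assert (sin p <= 0).
    { assert (0 <= sin (- p)) by (apply sin_ge_0; generalize PI_RGT_0; lra).
      rewrite sin_neg in *. lra. }
    assert (A1 := atan_le (tan p) y ltac:(nra)). assert (A2 := atan_le y 0 ltac:(nra)).
    apply Rabs_def1; nra.
Qed.

(** The left side is [w] times, up to sign, the integral of exp (- t w) over [0, 1], whose integrand
    has modulus at most 1. *)
Lemma Cexpc_opp_minus_1 (w : C) : 0 <= fst w -> Cmod (Cminus (Cexpc (Copp w)) 1) <= Cmod w.
Proof.
  intros Hw. destruct (Req_EM_T (Cmod w) 0) as [E|E].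
  - apply Cmod_eq_0 in E. rewrite E. replace (Copp 0) with (RtoC 0) by ring. rewrite Cexpc_0.
    replace (Cminus 1 1) with (RtoC 0) by ring. lra.
  - assert (N : Copp w <> 0%C).
    { intros H. apply E. rewrite <- Cmod_opp, H. apply Cmod_0. }
    assert (I := CRInt_Cexpc_lin (Copp w) 0 1 N). rewrite Cmult_0_r, Cmult_1_r, Cexpc_0 in I.
    replace (Cminus (Cexpc (Copp w)) 1) with
      (Cmult (CRInt (fun t => Cexpc (Cmult (Copp w) (RtoC t))) 0 1) (Copp w)) by (rewrite I; field; intros H; apply N; rewrite H; ring).
    rewrite Cmod_mult, Cmod_opp. rewrite <- (Rmult_1_l (Cmod w)) at 2.
    apply Rmult_le_compat_r; [apply Cmod_ge_0|].
    eapply Rle_trans; [apply (CRInt_norm _ (fun _ => 1))|].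
    + ccont_tac.
    + intros; apply continuous_const.
    + lra.
    + intros x Hx. rewrite Cmod_Cexpc, <- exp_0. apply exp_le_compat. simpl. nra.
    + rewrite RInt_const. unfold scal; simpl; unfold mult; simpl. lra.
Qed.

Section Laplace.
Variables (B s : C) (beta : R).
Hypothesis HB : 0 < fst B.
Hypothesis Hs : 0 < fst s.
Hypothesis Hbeta : 0 < beta.

(** The same Laplace integrand with [k] explicit, so that [k = 0], where k s has no logarithm, is
    included; exp v plays the squared distance. *)
Definition laplace_kernel (k v : R) : C :=
  Cexpc (Cminus (Cminus (RtoC v) (Cmult B (RtoC (exp v)))) (Cmult (RtoC (k * exp (beta * v))) s)).

Lemma laplace_kernel_ccont k : ccont (laplace_kernel k).
Proof.
  unfold laplace_kernel. ccont_tac; intros x.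
  - apply continuous_exp.
  - apply continuous_scal_R. apply (continuous_ex_derive (fun u => exp (beta * u))). auto_derive. auto.
Qed.

Lemma laplace_kernel_0_mod v : Cmod (laplace_kernel 0 v) = exp (- (fst B * exp v) + 1 * v).
Proof. unfold laplace_kernel. rewrite Cmod_Cexpc. f_equal. simpl. ring. Qed.

Lemma laplace_kernel_split k v : laplace_kernel k v = Cmult (laplace_kernel 0 v) (Cexpc (Copp (Cmult (RtoC (k * exp (beta * v))) s))).
Proof. unfold laplace_kernel. rewrite <- Cexpc_plus. f_equal. rewrite Rmult_0_l. ring. Qed.

Lemma laplace_kernel_ex k : 0 <= k -> exists I, is_CInt (laplace_kernel k) I.
Proof.
  intros Hk. destruct (double_exp_le_sech (fst B) 1 HB Rlt_0_1) as [K [HK Bd]].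
  apply (is_CInt_ex _ (fun v => K * sech 1 v)).
  - apply laplace_kernel_ccont.
  - apply majorant_scal; [lra|]. apply majorant_sech; lra.
  - intros v. rewrite laplace_kernel_split, Cmod_mult, laplace_kernel_0_mod, Cmod_Cexpc.
    assert (H1 := Bd v).
    assert (H2 : exp (fst (Copp (Cmult (RtoC (k * exp (beta * v))) s))) <= 1).
    { rewrite <- exp_0. apply exp_le_compat. simpl.
      assert (0 <= k * exp (beta * v)) by (apply Rmult_le_pos; auto; left; apply exp_pos). nra. }
    generalize (exp_pos (fst (Copp (Cmult (RtoC (k * exp (beta * v))) s)))) (exp_pos (- (fst B * exp v) + 1 * v)).
    nra.
Qed.

Lemma laplace_kernel_0_is_CInt : is_CInt (laplace_kernel 0) (Cinv B).
Proof.
  assert (NB := Cnonzero_fst B HB). assert (PB : 0 < Cmod B) by now apply Cmod_gt_0.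
  intros eps He.
  (* [M1] serves the lower end, where exp (- B exp a) - 1 is of order exp a; [M2] serves the upper
     end, where exp b exceeds [b]. *)
  destruct (exp_neg_small 1 (eps / 2)) as [M1 [HM1 A1]]; [lra|lra|].
  destruct (exp_neg_small (fst B) (eps / 2 * Cmod B)) as [M2 [HM2 A2]]; auto.
  { apply Rmult_lt_0_compat; lra. }
  exists (M1 + M2). split; [lra|]. intros a b Ha Hb.
  rewrite (CRInt_cderiv (fun v => Copp (Cmult (Cinv B) (Cexpc (Copp (Cmult B (RtoC (exp v)))))))).
  2:{ intros v. eapply cderiv_eq.
      - apply cderiv_opp. apply cderiv_mult; [apply cderiv_const|]. apply cderiv_Cexpc, cderiv_opp.
        apply cderiv_mult; [apply cderiv_const|]. apply cderiv_RtoC, is_derive_exp.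
      - unfold laplace_kernel. replace (Cminus _ _) with (Cplus (RtoC v) (Copp (Cmult B (RtoC (exp v))))).
        + rewrite Cexpc_plus, Cexpc_R. field. auto.
        + rewrite Rmult_0_l. ring. }
  2:{ apply laplace_kernel_ccont. }
  set (Ea := Cexpc (Copp (Cmult B (RtoC (exp a))))). set (Eb := Cexpc (Copp (Cmult B (RtoC (exp b))))).
  replace (Cminus _ _) with (Cmult (Cinv B) (Cminus (Cminus Ea 1) Eb)) by ring.
  rewrite Cmod_mult, Cmod_inv by auto.
  assert (H1 : Cmod (Cminus Ea 1) <= Cmod B * (eps / 2)).
  { unfold Ea. eapply Rle_trans; [apply Cexpc_opp_minus_1|].
    - simpl. generalize (exp_pos a). nra.
    - rewrite Cmod_mult. apply Rmult_le_compat_l; [lra|].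
      rewrite Cmod_R, Rabs_right by (left; apply exp_pos).
      eapply Rle_trans; [|apply A1]. apply exp_le_compat. lra. }
  assert (H2 : Cmod Eb <= eps / 2 * Cmod B).
  { unfold Eb. rewrite Cmod_Cexpc. eapply Rle_trans; [|apply A2]. apply exp_le_compat.
    simpl. generalize (exp_ineq1_le b). nra. }
  apply Rmult_le_reg_l with (Cmod B); auto.
  rewrite <- Rmult_assoc, Rinv_r, Rmult_1_l by lra.
  unfold Cminus at 1. eapply Rle_trans; [apply Cmod_triangle|]. rewrite Cmod_opp. lra.
Qed.

(** The bound |exp (- w) - 1| <= |w| brings in the factor [k * exp (beta * v)], which only raises
    the exponent from 1 to [1 + beta]; the majorant therefore persists, with a constant independent
    of [k]. *)
Lemma laplace_kernel_lipschitz : exists C, 0 <= C /\ forall k I, 0 <= k -> is_CInt (laplace_kernel k) I -> Cmod (Cminus I (Cinv B)) <= k * C.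
Proof.
  assert (Hb1 : 0 < 1 + beta) by lra.
  destruct (double_exp_le_sech (fst B) (1 + beta) HB Hb1) as [K [HK Bd]].
  destruct (majorant_sech (1 + beta) Hb1) as [Cs [_ [[L HL] _]]].
  assert (HL0 : 0 <= L) by (generalize (HL 0 0 (Rle_refl 0)); rewrite RInt_point; auto).
  exists (Cmod s * K * L). assert (Hs0 := Cmod_ge_0 s).
  assert (HsK : 0 <= Cmod s * K) by nra.
  split; [apply Rmult_le_pos; lra|]. intros k I Hk HI.
  apply (is_CInt_bound (fun v => Cminus (laplace_kernel k v) (laplace_kernel 0 v)) (fun v => k * (Cmod s * K) * sech (1 + beta) v)).
  - apply ccont_minus; apply laplace_kernel_ccont.
  - intros; now apply continuous_scal_R.
  - intros v. rewrite laplace_kernel_split.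
    set (w := Cmult (RtoC (k * exp (beta * v))) s).
    replace (Cminus _ _) with (Cmult (laplace_kernel 0 v) (Cminus (Cexpc (Copp w)) 1)) by ring.
    rewrite Cmod_mult, laplace_kernel_0_mod.
    assert (Hp : 0 <= k * exp (beta * v)) by (apply Rmult_le_pos; auto; left; apply exp_pos).
    assert (H1 : Cmod (Cminus (Cexpc (Copp w)) 1) <= Cmod w).
    { apply Cexpc_opp_minus_1. unfold w; simpl. nra. }
    assert (H2 : Cmod w = k * exp (beta * v) * Cmod s).
    { unfold w. rewrite Cmod_mult, Cmod_R, Rabs_right; lra. }
    apply Rle_trans with (exp (- (fst B * exp v) + 1 * v) * (k * exp (beta * v) * Cmod s)).
    { apply Rmult_le_compat_l; [left; apply exp_pos|]. lra. }
    replace (exp (- (fst B * exp v) + 1 * v) * (k * exp (beta * v) * Cmod s))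
      with (k * Cmod s * (exp (- (fst B * exp v) + 1 * v) * exp (beta * v))) by ring.
    rewrite <- exp_plus.
    replace (- (fst B * exp v) + 1 * v + beta * v) with (- (fst B * exp v) + (1 + beta) * v) by ring.
    replace (k * (Cmod s * K) * sech (1 + beta) v) with (k * Cmod s * (K * sech (1 + beta) v)) by ring.
    apply Rmult_le_compat_l; [nra|]. apply Bd.
  - intros a b Hab. rewrite RInt_scal_R; auto.
    replace (k * (Cmod s * K * L)) with (k * (Cmod s * K) * L) by ring.
    apply Rmult_le_compat_l; auto. apply Rmult_le_pos; auto.
  - apply is_CInt_minus; auto using laplace_kernel_ccont, laplace_kernel_0_is_CInt.
Qed.

Lemma laplace_kernel_laplace_integrand k : 0 < k ->
  forall v, laplace_kernel k v = laplace_integrand beta (Clogc (Cmult (RtoC k) s)) (Clogc B) v.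
Proof.
  intros Hk v. unfold laplace_kernel, laplace_integrand. f_equal.
  rewrite !Cexpc_plus, !Cexpc_Clogc, <- RtoC_mult, !Cexpc_R; auto.
  - rewrite RtoC_mult. ring.
  - simpl. nra.
Qed.

(** The argument of [FoxH] is exp w with w = S - beta b, and the angle hypothesis makes [w] its
    principal logarithm. Then - xi w = b - (xi S + eta b) with eta = 1 - beta xi, and the extra exp
    b is the factor [B] on the right. *)
Lemma FoxH_laplace_kernel alpha g k I : beta = alpha / 2 -> 0 < g < 2 / alpha -> 0 < k ->
  Rabs (snd (Cminus (Clogc (Cmult (RtoC k) s)) (Cmult (RtoC beta) (Clogc B)))) < PI / 2 ->
  is_CInt (laplace_kernel k) I ->
  FoxH alpha g (Cmult (Cmult (RtoC k) s) (Cpowc B (RtoC (- (alpha / 2))))) = Cmult B I.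
Proof.
  intros Eb Hg Hk Ha HI.
  set (S := Clogc (Cmult (RtoC k) s)) in *. set (b := Clogc B) in *.
  assert (Hks : 0 < fst (Cmult (RtoC k) s)) by (simpl; nra).
  assert (HS : Rabs (snd S) < PI / 2) by now apply Clogc_snd_bound.
  assert (Hb : Rabs (snd b) < PI / 2) by now apply Clogc_snd_bound.
  set (w := Cminus S (Cmult (RtoC beta) b)) in *.
  replace (Cmult (Cmult (RtoC k) s) (Cpowc B (RtoC (- (alpha / 2))))) with (Cexpc w).
  2:{ rewrite Cpowc_eq by auto. fold b. rewrite <- (Cexpc_Clogc (Cmult (RtoC k) s)) by auto. fold S.
      rewrite <- Cexpc_plus. f_equal. unfold w. rewrite Eb, RtoC_opp. ring. }
  assert (Hw := Cexpc_fst_pos w Ha).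
  unfold FoxH. destruct (Req_EM_T (fst (Cexpc w)) 0); [lra|].
  assert (Hal : 0 < alpha) by lra.
  assert (Hbg : beta * g < 1).
  { destruct Hg as [_ Hg]. apply Rmult_lt_compat_l with (r := beta) in Hg; auto.
    replace (beta * (2 / alpha)) with 1 in Hg by (rewrite Eb; field; lra). auto. }
  apply (is_CInt_ext _ _ _ (laplace_kernel_laplace_integrand k Hk)) in HI. fold S b in HI.
  destruct (mellin_barnes beta g S b I Hbeta (proj1 Hg) Hbg HS Hb HI) as [CF IF].
  set (F := fun t => _) in CF, IF.
  cbv zeta.
  assert (E : forall t,
      Cmult (Cmult (CGamma (g, t)) (CGamma (Cminus 1%C (Cmult (RtoC (alpha / 2)) (g, t)))))
            (Cpowc (Cexpc w) (Copp (g, t))) = Cmult B (F t)).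
  { intros t. unfold F. cbv zeta. rewrite Cpowc_eq by auto. rewrite Clogc_Cexpc by auto.
    rewrite <- Eb.
    replace (Cexpc (Cmult (Copp (g, t)) w)) with (Cmult (Cexpc b) (Cexpc (Copp (Cplus (Cmult (g, t) S)
      (Cmult (Cminus 1 (Cmult (RtoC beta) (g, t))) b))))) by (rewrite <- Cexpc_plus; f_equal; unfold w; ring).
    unfold b at 1. rewrite Cexpc_Clogc by auto. ring. }
  rewrite (functional_extensionality _ _ E).
  rewrite (CIntR_eq _ (Cmult B (Cmult (RtoC (2 * PI)) I))).
  - rewrite RtoC_inv by (generalize PI_RGT_0; lra). field. intros H. apply (f_equal fst) in H. simpl in H. generalize PI_RGT_0; lra.
  - apply ccont_mult; auto using ccont_const.
  - now apply is_CInt_mult.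
Qed.
End Laplace.

(** * The transform [phi] and the angle of the Fox argument *)

Lemma continuous_Rpow0 alpha x : 2 < alpha -> continuous (fun d => Rpow0 d alpha) x.
Proof.
  intros Ha. destruct (Rtotal_order x 0) as [H|[H|H]].
  - apply continuous_ext_loc with (fun _ => 0); [|apply continuous_const].
    assert (Hx : 0 < - x) by lra. exists (mkposreal _ Hx). intros y Hy.
    change (Rabs (y - x) < - x) in Hy. apply Rabs_def2 in Hy.
    unfold Rpow0. destruct (Rle_dec y 0); [auto|lra].
  (* The branches meet at 0 because y^alpha <= y for 0 < y < 1, whence the minimum with 1. *)
  - subst x. apply continuity_pt_filterlim, continuity_pt_locally. intros eps.
    assert (He : 0 < Rmin eps 1) by (apply Rmin_glb_lt; [apply cond_pos|lra]).
    exists (mkposreal _ He). intros y Hy. change (Rabs (y - 0) < Rmin eps 1) in Hy.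
    rewrite Rminus_0_r in Hy. assert (M1 := Rmin_l eps 1). assert (M2 := Rmin_r eps 1).
    unfold Rpow0. destruct (Rle_dec 0 0); [|lra]. rewrite Rminus_0_r.
    destruct (Rle_dec y 0); [rewrite Rabs_R0; apply cond_pos|].
    rewrite (Rabs_right y) in Hy by lra.
    unfold Rpower. rewrite Rabs_right by (left; apply exp_pos).
    apply Rle_lt_trans with y; [|lra].
    rewrite <- (exp_ln y) at 2 by lra. apply exp_le_compat.
    assert (ln y < 0) by (rewrite <- ln_1; apply ln_increasing; lra). nra.
  - apply (continuous_ext_pos _ (fun d => exp (alpha * ln d))); auto.
    + intros y Hy. unfold Rpow0, Rpower. destruct (Rle_dec y 0); [lra|auto].
    + apply (continuous_ex_derive (fun d => exp (alpha * ln d))). auto_derive. auto.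
Qed.

Lemma Rpow0_nonneg x a : 0 <= Rpow0 x a.
Proof. unfold Rpow0. destruct (Rle_dec x 0); [lra|]. left. apply exp_pos. Qed.

(** With r the squared distance, the density of the maximum is a constant times exp (- m r) - exp (-
    2 m r), where m = c lam pi. The interference term is also linear in r and joins the two
    exponents, giving the Laplace parameters pi lam [A1] and pi lam [A2]. *)
Lemma phi_eq alpha lam omega sig2 P s I1 I2 :
  2 < alpha -> 0 < lam -> 0 < P -> 0 <= sig2 -> 0 < omega -> 0 < fst s ->
  let sa := Cpowc s (RtoC (2 / alpha)) in 0 < fst sa ->
  let A1 := Cplus (RtoC ccst) (Cmult (RtoC omega) sa) in
  let A2 := Cplus (RtoC (2 * ccst)) (Cmult (RtoC omega) sa) in
  is_CInt (laplace_kernel (Cmult (RtoC (PI * lam)) A1) s (alpha / 2) (sig2 / P)) I1 ->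
  is_CInt (laplace_kernel (Cmult (RtoC (PI * lam)) A2) s (alpha / 2) (sig2 / P)) I2 ->
  phi alpha lam omega sig2 P s = Cmult (RtoC (2 * ccst * (PI * lam))) (Cminus I1 I2).
Proof.
  intros Ha Hl HP Hs2 Ho Hs sa Hsa A1 A2 H1 H2. unfold phi. fold sa.
  assert (Hk : 0 <= sig2 / P) by (apply Rmult_le_pos; auto; left; now apply Rinv_0_lt_compat).
  set (k := sig2 / P) in *. assert (HPI := PI_RGT_0).
  apply (Emax_eq lam (1 / 2)); auto; [lra| | |].
  - ccont_tac; intros x.
    + apply continuous_scal_R. now apply continuous_Rpow0.
    + apply (continuous_ex_derive (fun u => PI * lam * omega * u ^ 2)). auto_derive. auto.
  - intros x. rewrite Cmod_Cexpc, <- exp_0. apply exp_le_compat. simpl.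
    assert (0 <= k * Rpow0 x alpha) by (apply Rmult_le_pos; auto using Rpow0_nonneg).
    assert (0 <= PI * lam * omega * (x * (x * 1))).
    { apply Rmult_le_pos; [|nra]. apply Rmult_le_pos; [|lra]. nra. }
    nra.
  - assert (H := is_CInt_mult (RtoC (2 * ccst * (PI * lam))) _ _
       (ccont_minus _ _ (laplace_kernel_ccont _ _ _ _) (laplace_kernel_ccont _ _ _ _))
       (is_CInt_minus _ _ _ _ (laplace_kernel_ccont _ _ _ _) (laplace_kernel_ccont _ _ _ _) H1 H2)).
    revert H. apply is_CInt_ext. intros v. cbv zeta.
    set (x := exp (1 / 2 * v)).
    assert (Hx : 0 < x) by apply exp_pos.
    assert (Ex : x ^ 2 = exp v).
    { simpl. rewrite Rmult_1_r. unfold x. rewrite <- exp_plus. f_equal. field. }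
    assert (Ep : Rpow0 x alpha = exp (alpha / 2 * v)).
    { unfold Rpow0. destruct (Rle_dec x 0); [lra|]. unfold Rpower, x. rewrite ln_exp. f_equal. field. }
    rewrite Ep. unfold fd. rewrite Ex.
    set (m := ccst * lam * PI).
    set (T := Cminus (Copp (Cmult (RtoC (k * exp (alpha / 2 * v))) s)) (Cmult (RtoC (PI * lam * omega * exp v)) sa)).
    replace (RtoC (1 / 2 * x * (2 * (1 - exp (- (m * exp v))) * (2 * ccst * lam * PI * x * exp (- (m * exp v))))))
      with (Cmult (RtoC (2 * ccst * (PI * lam))) (Cminus (RtoC (exp (v + - (m * exp v)))) (RtoC (exp (v + - (2 * m * exp v)))))).
    2:{ rewrite <- RtoC_minus, <- RtoC_mult. f_equal.
        replace (- (2 * m * exp v)) with (- (m * exp v) + - (m * exp v)) by ring.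
        rewrite !exp_plus, <- Ex. field. }
    rewrite <- Cmult_assoc. f_equal.
    rewrite <- !Cexpc_R.
    replace (Cmult (Cminus (Cexpc (RtoC (v + - (m * exp v)))) (Cexpc (RtoC (v + - (2 * m * exp v))))) (Cexpc T))
      with (Cminus (Cmult (Cexpc (RtoC (v + - (m * exp v)))) (Cexpc T)) (Cmult (Cexpc (RtoC (v + - (2 * m * exp v)))) (Cexpc T))) by ring.
    rewrite <- !Cexpc_plus. unfold laplace_kernel.
    apply (f_equal2 Cminus); apply (f_equal Cexpc); unfold T, A1, A2, m;
    unfold Cminus, Cplus, Copp, Cmult, RtoC; cbn [fst snd]; apply (f_equal2 pair); ring.
Qed.

(** The exponent 2 / alpha is below 1, so the argument shrinks and stays inside (-pi/2, pi/2). *)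
Lemma Re_Cpowc_root_pos alpha (s : C) : 2 < alpha -> 0 < fst s ->
  0 < fst (Cpowc s (RtoC (2 / alpha))).
Proof.
  intros Ha Hs. rewrite Cpowc_eq by auto. apply Cexpc_fst_pos.
  replace (snd _) with (2 / alpha * snd (Clogc s)) by (simpl; ring).
  rewrite Rabs_mult. assert (H := Clogc_snd_bound s Hs).
  assert (0 < 2 / alpha) by (apply Rdiv_lt_0_compat; lra).
  assert (2 / alpha < 1) by (apply Rmult_lt_reg_r with alpha; [lra|]; unfold Rdiv; rewrite Rmult_assoc, Rinv_l; lra).
  rewrite (Rabs_right (2 / alpha)) by lra. generalize (Rabs_pos (snd (Clogc s))). nra.
Qed.

Lemma shifted_fst_pos (mu c omega : R) (sa : C) : 0 < mu -> 0 < c -> 0 < omega -> 0 < fst sa ->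
  0 < fst (Cmult (RtoC mu) (Cplus (RtoC c) (Cmult (RtoC omega) sa))).
Proof. intros. simpl. assert (0 < omega * fst sa) by nra. nra. Qed.

(** Positive factors [k] and [mu] leave arguments unchanged. With th = arg s, the root has argument
    p = th / (alpha / 2), and [r] is the modulus of omega times the root; what remains is the
    elementary estimate on arctangents. *)
Lemma FoxH_argument_angle alpha mu c omega k (s : C) :
  2 < alpha -> 0 < mu -> 0 < c -> 0 < omega -> 0 < k -> 0 < fst s ->
  Rabs (snd (Cminus (Clogc (Cmult (RtoC k) s)) (Cmult (RtoC (alpha / 2))
    (Clogc (Cmult (RtoC mu) (Cplus (RtoC c) (Cmult (RtoC omega) (Cpowc s (RtoC (2 / alpha)))))))))) < PI / 2.
Proof.
  intros Ha Hmu Hc Ho Hk Hs.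
  assert (Hsa := Re_Cpowc_root_pos alpha s Ha Hs).
  assert (HB := shifted_fst_pos mu c omega _ Hmu Hc Ho Hsa).
  set (sa := Cpowc s (RtoC (2 / alpha))) in *.
  assert (Hks : 0 < fst (Cmult (RtoC k) s)) by (simpl; nra).
  set (w := Clogc (Cmult (RtoC mu) _)) in *.
  replace (snd (Cminus _ _)) with (snd (Clogc (Cmult (RtoC k) s)) - alpha / 2 * snd w).
  2:{ generalize (Clogc (Cmult (RtoC k) s)) w. intros x y. simpl. ring. }
  unfold w. rewrite !Clogc_snd by auto.
  assert (Hth := Clogc_snd_bound s Hs). rewrite Clogc_snd in Hth by auto.
  set (th := atan (snd s / fst s)) in *.
  replace (atan (snd (Cmult (RtoC k) s) / fst (Cmult (RtoC k) s))) with th.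
  2:{ unfold th. f_equal. simpl. field. split; nra. }
  assert (Esa : sa = Cexpc (2 / alpha * ln (Cmod s), th / (alpha / 2))).
  { unfold sa. rewrite Cpowc_eq by auto. f_equal.
    rewrite (surjective_pairing (Clogc s)), (Clogc_snd s Hs). fold th.
    unfold Cmult, RtoC, Clogc; cbn [fst snd]. f_equal; field; lra. }
  set (p := th / (alpha / 2)) in *.
  assert (Hp : Rabs p < PI / 2).
  { unfold p, Rdiv. rewrite Rabs_mult, (Rabs_right (/ (alpha * / 2))) by (left; apply Rinv_0_lt_compat; lra).
    assert (0 < / (alpha * / 2) < 1).
    { split; [apply Rinv_0_lt_compat; lra|]. rewrite <- Rinv_1. apply Rinv_lt_contravar; lra. }
    generalize (Rabs_pos th). unfold Rdiv in Hth. nra. }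
  set (r := omega * exp (2 / alpha * ln (Cmod s))).
  assert (Hr : 0 < r) by (apply Rmult_lt_0_compat; auto; apply exp_pos).
  assert (Hcos : 0 < cos p) by (apply Rabs_def2 in Hp; apply cos_gt_0; lra).
  match goal with |- context [atan ?y] => replace y with (r * sin p / (c + r * cos p)) end.
  - apply (angle_bound (alpha / 2) th c r); auto. lra.
  - rewrite Esa. unfold r. simpl. field.
    assert (0 < omega * (exp (2 / alpha * ln (Cmod s)) * cos p)) by (fold r; unfold r in Hr; nra).
    repeat split; nra.
Qed.

Theorem theorem1 (alpha lam P sig2 omega : R) (s : C) :
  2 < alpha -> 0 < lam -> 0 < P -> 0 <= sig2 -> 0 < omega -> 0 < Re s ->
  let sa := Cpowc s (RtoC (2 / alpha)) in
  let A1 := Cplus (RtoC ccst) (Cmult (RtoC omega) sa) in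
  let A2 := Cplus (RtoC (2 * ccst)) (Cmult (RtoC omega) sa) in
  (forall gam : R, 0 < gam < 2 / alpha ->
     phi alpha lam omega sig2 P s =
     Cminus
       (Cmult (Cdiv (RtoC (2 * ccst)) A1)
          (FoxH alpha gam (Cmult (Cmult (RtoC (sig2 / P)) s)
             (Cpowc (Cmult (RtoC (PI * lam)) A1) (RtoC (- (alpha / 2)))))))
       (Cmult (Cdiv (RtoC (2 * ccst)) A2)
          (FoxH alpha gam (Cmult (Cmult (RtoC (sig2 / P)) s)
             (Cpowc (Cmult (RtoC (PI * lam)) A2) (RtoC (- (alpha / 2))))))))
  /\
  filterlim (fun k : R => phi alpha lam omega k P s) (at_right 0)
    (locally (Cminus (Cdiv (RtoC (2 * ccst)) A1) (Cdiv (RtoC (2 * ccst)) A2))).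
Proof.
  intros Ha Hl HP Hs2 Ho Hs sa A1 A2. change (0 < fst s) in Hs.
  assert (HPI := PI_RGT_0).
  assert (Hmu : 0 < PI * lam) by nra.
  assert (Hc : 0 < ccst) by (unfold ccst; lra).
  assert (Hsa : 0 < fst sa) by now apply Re_Cpowc_root_pos.
  assert (HB1 := shifted_fst_pos (PI * lam) ccst omega sa Hmu Hc Ho Hsa).
  assert (Hc2 : 0 < 2 * ccst) by lra.
  assert (HB2 := shifted_fst_pos (PI * lam) (2 * ccst) omega sa Hmu Hc2 Ho Hsa).
  fold A1 in HB1. fold A2 in HB2.
  assert (Nmu : RtoC (PI * lam) <> 0%C) by (apply Cnonzero_fst; auto).
  assert (NA1 : A1 <> 0%C) by (apply Cnonzero_fst; unfold A1; simpl; nra).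
  assert (NA2 : A2 <> 0%C) by (apply Cnonzero_fst; unfold A2; simpl; nra).
  assert (Hbeta : 0 < alpha / 2) by lra.
  split.
  - intros gam Hgam.
    assert (Hk : 0 <= sig2 / P) by (apply Rmult_le_pos; auto; left; now apply Rinv_0_lt_compat).
    destruct (laplace_kernel_ex _ s (alpha / 2) HB1 Hs _ Hk) as [I1 H1].
    destruct (laplace_kernel_ex _ s (alpha / 2) HB2 Hs _ Hk) as [I2 H2].
    rewrite (phi_eq alpha lam omega sig2 P s I1 I2); auto. fold sa.
    assert (E : forall c A I, 0 < c -> A = Cplus (RtoC c) (Cmult (RtoC omega) sa) ->
       0 < fst (Cmult (RtoC (PI * lam)) A) -> is_CInt (laplace_kernel (Cmult (RtoC (PI * lam)) A) s (alpha / 2) (sig2 / P)) I ->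
       FoxH alpha gam (Cmult (Cmult (RtoC (sig2 / P)) s) (Cpowc (Cmult (RtoC (PI * lam)) A) (RtoC (- (alpha / 2)))))
       = Cmult (Cmult (RtoC (PI * lam)) A) I).
    { intros c A I Hc0 EA HB HI. destruct Hk as [Hk|Hk].
      - apply (FoxH_laplace_kernel _ s (alpha / 2)); auto. rewrite EA. now apply FoxH_argument_angle.
      (* Zero noise: [FoxH] at 0 is 1 by definition, and the Laplace integral is the inverse of its
         parameter. *)
      - rewrite <- Hk in *.
        rewrite (is_CInt_unique _ _ _ HI (laplace_kernel_0_is_CInt _ s (alpha / 2) HB)).
        rewrite !Cmult_0_l. unfold FoxH. simpl.
        destruct (Req_EM_T 0 0); [|lra].
        symmetry. apply Cinv_r. now apply Cnonzero_fst. }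
    rewrite (E ccst A1 I1), (E (2 * ccst) A2 I2); auto.
    (* Each [FoxH] value is pi lam A times its Laplace integral, so A cancels against
       [2 * ccst / A]. *)
    rewrite !RtoC_mult. rewrite RtoC_mult in Nmu. field. auto.
  - destruct (laplace_kernel_lipschitz _ s (alpha / 2) HB1 Hs Hbeta) as [C1 [HC1 L1]].
    destruct (laplace_kernel_lipschitz _ s (alpha / 2) HB2 Hs Hbeta) as [C2 [HC2 L2]].
    apply filterlim_locally. intros eps.
    (* The Lipschitz constant of [phi] in the noise power, plus 1 so that it can be divided by. *)
    set (D := 2 * ccst * (PI * lam) * (C1 + C2) / P + 1).
    assert (HD : 0 < D).
    { unfold D. assert (0 <= 2 * ccst * (PI * lam) * (C1 + C2) / P); [|lra].
      apply Rmult_le_pos; [|left; now apply Rinv_0_lt_compat]. apply Rmult_le_pos; nra. }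
    assert (Hd : 0 < eps / D) by (apply Rdiv_lt_0_compat; auto; apply cond_pos).
    exists (mkposreal _ Hd). simpl. intros k Hk1 Hk0. change (Rabs (k - 0) < eps / D) in Hk1.
    rewrite Rminus_0_r, Rabs_right in Hk1 by lra.
    assert (Hk : 0 <= k / P) by (apply Rmult_le_pos; [lra|]; left; now apply Rinv_0_lt_compat).
    destruct (laplace_kernel_ex _ s (alpha / 2) HB1 Hs _ Hk) as [I1 H1].
    destruct (laplace_kernel_ex _ s (alpha / 2) HB2 Hs _ Hk) as [I2 H2].
    rewrite (phi_eq alpha lam omega k P s I1 I2); auto; [|lra].
    assert (D1 := L1 _ _ Hk H1). assert (D2 := L2 _ _ Hk H2).
    apply C_NormedModule_mixin_compat1.
    set (B1 := Cmult (RtoC (PI * lam)) A1) in *. set (B2 := Cmult (RtoC (PI * lam)) A2) in *.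
    match goal with |- Cmod (minus ?a ?b) < _ =>
      change (minus a b) with (Cminus a b);
      replace (Cminus a b) with
        (Cmult (RtoC (2 * ccst * (PI * lam))) (Cminus (Cminus I1 (Cinv B1)) (Cminus I2 (Cinv B2))))
    end.
    2:{ unfold B1, B2. rewrite (RtoC_mult (2 * ccst)). field. auto. }
    rewrite Cmod_mult, Cmod_R, Rabs_right by nra.
    apply Rle_lt_trans with (2 * ccst * (PI * lam) * (k / P * C1 + k / P * C2)).
    + apply Rmult_le_compat_l; [nra|]. unfold Cminus at 1. eapply Rle_trans; [apply Cmod_triangle|].
      rewrite Cmod_opp. lra.
    + replace (2 * ccst * (PI * lam) * (k / P * C1 + k / P * C2)) with (k * (D - 1)) by (unfold D; field; lra).
      apply Rlt_le_trans with (eps / D * D); [nra|]. right. field. lra.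
Qed.
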